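(* Let $k,d\ge1$ be integers, $0<t_0<T$, $\beta\in\,]0,2\wedge k[$, and let $u=\{u(t,x),\ (t,x)\in[0,T]\times\mathbb{R}^k\}$ be the $\mathbb{R}^d$-valued solution of the linear stochastic wave system driven by spatially homogeneous Gaussian noise with spectral measure $\mu(d\xi)=\|\xi\|^{-k+\beta}d\xi$ (defined in the context). Fix $M>0$. Then there exist positive constants $C_1$, $C_2$ such that for any $(t,x),(s,y)\in[t_0,T]\times[-M,M]^k$, $$C_1\left(|t-s|+\|x-y\|\right)^{2-\beta}\le E\left(\|u(t,x)-u(s,y)\|^2\right)\le C_2\left(|t-s|+\|x-y\|\right)^{2-\beta}.$$
   Context: The process $u$. Let $\sigma=(\sigma_{i,j})$ be a fixed deterministic invertible $d\times d$ matrix (constants may depend on it). $u=(u_1,\dots,u_d)$ is the solution of $$\frac{\partial^2u_i}{\partial t^2}(t,x)-\Delta u_i(t,x)=\sum_{j=1}^d\sigma_{i,j}\dot F^j(t,x),\qquad u_i(0,x)=\frac{\partial u_i}{\partial t}(0,x)=0,$$ where $\dot F=(\dot F^1,\dots,\dot F^d)$ has i.i.d. centered Gaussian components, white in time and spatially homogeneous, with $E(F^i(\varphi)F^i(\psi))=\int_{\mathbb{R}_+}dr\int_{\mathbb{R}^k}\mu(d\xi)\,\mathcal{F}\varphi(r,\cdot)(\xi)\,\overline{\mathcal{F}\psi(r,\cdot)(\xi)}$ for test functions $\varphi,\psi\in C_0^\infty(\mathbb{R}^{k+1})$, $\mathcal{F}$ denoting the Fourier transform in space. Here $\mu(d\xi)=\|\xi\|^{-k+\beta}d\xi$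 (equivalently, spatial covariance a constant multiple of $\|x\|^{-\beta}$). The solution is the stochastic convolution $u_i(t,x)=\int_0^t\int_{\mathbb{R}^k}G(t-r,x-y)\sum_j\sigma_{i,j}M^j(dr,dy)$, where $G$ is the fundamental solution of the wave equation, with $\mathcal{F}G(t)(\xi)=\sin(t\|\xi\|)/\|\xi\|$, and $M=(M^1,\dots,M^d)$ is the martingale measure derived from $\dot F$. Equivalently, $u$ is the centered Gaussian random field with $$E(u_i(t,x)u_j(s,y))=(\sigma\sigma^{\mathsf T})_{i,j}\int_0^{t\wedge s}dr\int_{\mathbb{R}^k}\mu(d\xi)\,e^{\mathrm{i}\xi\cdot(x-y)}\,\frac{\sin((t-r)\|\xi\|)\sin((s-r)\|\xi\|)}{\|\xi\|^2}.$$ $\|\cdot\|$ is the Euclidean norm. *)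

(* Defs.v *)
From HB Require Import structures.
From mathcomp Require Import all_boot all_order all_algebra.
From mathcomp Require Import complex.
From mathcomp Require Import all_classical all_reals all_analysis.

Set Implicit Arguments.
Unset Strict Implicit.
Unset Printing Implicit Defensive.

Import Order.TTheory GRing.Theory Num.Theory.
Import numFieldNormedType.Exports.

Local Open Scope classical_set_scope.
Local Open Scope ring_scope.

(* The library norm `|x| on 'rV[R]_n is the sup norm, hence a separate
   Euclidean norm. *)
Definition dotp (R : realType) (n : nat) (x y : 'rV[R]_n) : R :=
  \sum_(i < n) x 0 i * y 0 i.

Definition enorm (R : realType) (n : nat) (x : 'rV[R]_n) : R :=
  Num.sqrt (dotp x x).

(* Lebesgue measure on R^n, carried by n.-tuple R because this is the type on
   which the library puts the product sigma-algebra. *)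
Section lebesgue_measure_tuple.
Local Open Scope ereal_scope.
Context (R : realType).

Definition tuple_cons (n : nat) (x : measurableTypeR R *
    n.-tuple (measurableTypeR R)) : n.+1.-tuple (measurableTypeR R) :=
  [the n.+1.-tuple _ of x.1 :: x.2].

Lemma measurable_tuple_cons (n : nat) :
  measurable_fun [set: measurableTypeR R * n.-tuple (measurableTypeR R)]
    (@tuple_cons n).
Proof. exact: measurable_cons. Qed.

Section step.
Variables (n : nat).
Variable m : {sigma_finite_measure set (n.-tuple (measurableTypeR R)) -> \bar R}.

Definition lebesgue_cons : set (n.+1.-tuple (measurableTypeR R)) -> \bar R :=
  pushforward (@lebesgue_measure R \x m) (@tuple_cons n).

Let mcons := @measurable_tuple_cons n.

Let lebesgue_cons0 : lebesgue_cons set0 = 0.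
Proof. by rewrite /lebesgue_cons /pushforward preimage_set0 measure0. Qed.

Let lebesgue_cons_ge0 A : 0 <= lebesgue_cons A.
Proof. exact: measure_ge0. Qed.

Let lebesgue_cons_sigma_additive : semi_sigma_additive lebesgue_cons.
Proof.
move=> F mF tF mUF; rewrite /lebesgue_cons /pushforward preimage_bigcup.
apply: measure_semi_sigma_additive.
- by move=> i; rewrite -[X in measurable X]setTI; exact: mcons.
- apply/trivIsetP => /= i j _ _ ij; rewrite -preimage_setI.
  by move/trivIsetP : tF => /(_ _ _ _ _ ij) ->//; rewrite preimage_set0.
- by rewrite -preimage_bigcup -[X in measurable X]setTI; exact: mcons.
Qed.

HB.instance Definition _ := isMeasure.Build _ _ _ lebesgue_cons
  lebesgue_cons0 lebesgue_cons_ge0 lebesgue_cons_sigma_additive.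

Let lebesgue_cons_sigma_finite : sigma_finite setT lebesgue_cons.
Proof.
have /sigma_finiteP[F [TF ndF Foo]] := sigma_finiteT (@lebesgue_measure R).
have /sigma_finiteP[G [TG ndG Goo]] := sigma_finiteT m.
pose H i := F i `*` G i.
have TH : setT = \bigcup_i H i.
  rewrite -setXTT TF TG predeqE => -[x y]; split.
    move=> [/= [i _ Fx] [j _ Gy]]; exists (maxn i j) => //; split.
    - by move: x Fx; exact/subsetPset/ndF/leq_maxl.
    - by move: y Gy; exact/subsetPset/ndG/leq_maxr.
  by move=> [i _ []/= ? ?]; split; exists i.
have Hoo i : measurable (H i) /\ (@lebesgue_measure R \x m) (H i) < +oo.
  have [? ?] := Foo i; have [? ?] := Goo i.
  split; first exact: measurableX.
  by rewrite product_measure1E// lte_mul_pinfty// ge0_fin_numE.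
pose g (x : n.+1.-tuple (measurableTypeR R)) : measurableTypeR R *
  n.-tuple (measurableTypeR R) := (thead x, [tuple of behead x]).
have mg : measurable_fun setT g.
  apply/measurable_fun_pairP; split; first exact: measurable_tnth.
  exact: measurable_behead.
have gK : cancel (@tuple_cons n) g.
  move=> [a b]; rewrite /g /tuple_cons /=; congr pair.
  exact: val_inj.
exists (fun i => g @^-1` H i).
  apply/seteqP; split=> // x _.
  by have : [set: _] (g x) by []; rewrite TH => -[i _ Hi]; exists i.
move=> i; have [mH Hioo] := Hoo i; split.
  by rewrite -[X in measurable X]setTI; exact: mg.
rewrite /lebesgue_cons /pushforward -comp_preimage.
by rewrite (_ : g \o @tuple_cons n = id) //; apply/funext => x /=; rewrite gK.
Qed.

HB.instance Definition _ := Measure_isSigmaFinite.Build _ _ _ lebesgue_cons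
  lebesgue_cons_sigma_finite.

End step.

Fixpoint lebesgue_measure_tuple (n : nat) :
    {sigma_finite_measure set (n.-tuple (measurableTypeR R)) -> \bar R} :=
  match n with
  | 0 => [the {sigma_finite_measure set _ -> \bar R} of \d_[tuple]]
  | n'.+1 => [the {sigma_finite_measure set _ -> \bar R} of
               lebesgue_cons (lebesgue_measure_tuple n')]
  end.

End lebesgue_measure_tuple.

Definition row_of_tuple (R : realType) (n : nat)
    (x : n.-tuple (measurableTypeR R)) : 'rV[R]_n :=
  \row_(i < n) tnth x i.

Definition Cintegral (disp : measure_display) (X : measurableType disp)
    (R : realType) (mu : {measure set X -> \bar R}) (D : set X)
    (f : X -> R[i]) : R[i] :=
  ((\int[mu]_(x in D) complex.Re (f x))%R +i*
   (\int[mu]_(x in D) complex.Im (f x))%R)%C.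

Definition Cexpi (R : realType) (a : R) : R[i] := (cos a +i* sin a)%C.

(* Density of the spectral measure mu(dxi) = |xi|^(beta - k) dxi. *)
Definition spectral_density (R : realType) (k : nat) (beta : R)
    (xi : 'rV[R]_k) : R :=
  enorm xi `^ (beta - k%:R).

(* Fourier transform in space of the fundamental solution G(t) of the wave
   equation; its value at xi = 0, a Lebesgue-null point for k >= 1, is
   irrelevant. *)
Definition FG (R : realType) (k : nat) (t : R) (xi : 'rV[R]_k) : R :=
  sin (t * enorm xi) / enorm xi.

(* Integral over r in [0, t /\ s] and mu(dxi) of
   e^{i xi.(x - y)} FG(t - r)(xi) FG(s - r)(xi). *)
Definition wave_kernel (R : realType) (k : nat) (beta : R)
    (t : R) (x : 'rV[R]_k) (s : R) (y : 'rV[R]_k) : R[i] :=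
  Cintegral (@lebesgue_measure R) `[0, Num.min t s] (fun r =>
    Cintegral (lebesgue_measure_tuple R k) setT (fun p =>
      let xi := row_of_tuple p in
      Cexpi (dotp xi (x - y)) *
      (FG (t - r) xi * FG (s - r) xi * spectral_density beta xi)%:C%C)).

Section random_field.
Context (R : realType) (disp : measure_display) (Omega : measurableType disp).
Variable P : probability Omega R.

(* Centered normal law, Dirac mass at 0 allowed; s is the standard deviation. *)
Definition centered_gaussian (X : Omega -> R) : Prop :=
  exists s : R, forall A : set (measurableTypeR R), measurable A ->
    P (X @^-1` A) = if s == 0 then \d_(0 : measurableTypeR R) A
                    else normal_prob 0 s A.

Definition centered_gaussian_field (k d : nat) (T : R)
    (u : R -> 'rV[R]_k -> Omega -> 'rV[R]_d) : Prop :=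
  (forall t x i, 0 <= t <= T ->
     measurable_fun setT (fun w => u t x w 0 i : measurableTypeR R)) /\
  (forall (m : nat) (a : 'I_m -> R) (t : 'I_m -> R) (x : 'I_m -> 'rV[R]_k)
      (i : 'I_m -> 'I_d), (forall l, 0 <= t l <= T) ->
     centered_gaussian (fun w => \sum_(l < m) a l * u (t l) (x l) w 0 (i l))).

(* The solution on [0, T] x R^k of the linear stochastic wave system with zero
   initial conditions and noise sigma * dF/dt dx, F having spectral measure mu:
   the stochastic convolution of G with the noise is, by the Ito-Walsh-Dalang
   isometry, the centered Gaussian field with this covariance. *)
Definition stochastic_wave_solution (k d : nat) (sigma : 'M[R]_d) (beta T : R)
    (u : R -> 'rV[R]_k -> Omega -> 'rV[R]_d) : Prop :=
  centered_gaussian_field T u /\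
  (forall t x s y (i j : 'I_d), 0 <= t <= T -> 0 <= s <= T ->
     exists2 c : R, ('E_P[fun w => (u t x w 0 i * u s y w 0 j)%R] = c%:E)%E &
       c%:C%C = ((sigma *m sigma^T) i j)%:C%C * wave_kernel beta t x s y).

End random_field.

(* Main.v *)
Require Import Defs.
From HB Require Import structures.
From mathcomp Require Import all_boot all_order all_algebra.
From mathcomp Require Import complex.
From mathcomp Require Import ring lra.
From mathcomp Require Import all_classical all_reals all_analysis.
From mathcomp Require Import measurable_realfun.

(** By the covariance structure, the second moment of [u(t,x) - u(s,y)] is the
    trace of [sigma sigma^T] (positive, as [sigma] is invertible) times the
    variance [increment_kernel] of a scalar increment. For [s <= t], with
    [z = x - y] and [h = t - s], that variance is a sum of two nonnegative terms
    ([increment_kernelE]): the integral over [0 <= r <= s] and over frequencies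
    [xi] of
      [|xi|^(beta - k - 2) |e^(i xi.z) sin ((t - r)|xi|) - sin ((s - r)|xi|)|^2],
    and the contribution of the noise on [s, t]. Put [a = h + |z|].

    Upper bound. The integrands are dominated by a multiple of
    [|xi|^(beta - k) min(a, 1/|xi|)^2] ([FG_quadratic_le]), whose integral is at
    most a constant times [a^(2 - beta)] ([integral_profile]). The latter is
    reduced to dimension one: the function decreases with [|xi|], so it is below
    the product of the [k]-th roots of its values at the coordinates, and Tonelli
    gives the [k]-th power of an explicit integral of powers.

    Lower bound. With [c = cos (xi.z)] and [q = cos (h|xi|)], the time integral
    over [0, s] of the square is [s (1 - c q)] plus an oscillating term of size
    at most [|c - q| / |xi| <= (1 - c q) / |xi|]. For [|xi| >= 2 / t0] the mean
    therefore wins, and [1 - c q] is at least half of [sin^2 (xi.z)] and of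
    [sin^2 (h|xi|)] ([integral_wave_quad_ge]). Restricting [xi] to a cube
    [L, 2L]^k with [L] a large multiple of [1/a], one of these two phases runs over
    several radians along every line parallel to a suitable axis, so its squared
    sine has an average bounded below ([cube_sin2]). The weight
    [L^(beta - k - 2)] times the volume [L^k] is of order [a^(2 - beta)]. The
    cutoff [|xi| >= 2 / t0] is compatible with the scale [1/a] because [a] is
    bounded on the set of points considered. *)

Set Implicit Arguments.
Unset Strict Implicit.
Unset Printing Implicit Defensive.

Import Order.TTheory GRing.Theory Num.Theory.
Import numFieldNormedType.Exports.

Local Open Scope classical_set_scope.
Local Open Scope ring_scope.

(** * Lebesgue measure on R^n by Tonelli *)

Lemma integral_tuple_cons (R : realType) (n : nat)
    (f : n.+1.-tuple (measurableTypeR R) -> \bar R) :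
  measurable_fun setT f -> (forall p, 0 <= f p)%E ->
  (\int[lebesgue_measure_tuple R n.+1]_p f p =
   \int[@lebesgue_measure R]_x \int[lebesgue_measure_tuple R n]_v
     f (tuple_cons (x, v)))%E.
Proof.
move=> mf f0.
transitivity (\int[pushforward (@lebesgue_measure R \x
  lebesgue_measure_tuple R n)%E (@tuple_cons R n)]_p f p)%E => //.
rewrite ge0_integral_pushforward//; last exact: measurable_tuple_cons.
rewrite preimage_setT.
rewrite (fubini_tonelli1 (f \o @tuple_cons R n))//; last first.
  by move=> p; exact: f0.
by apply: measurableT_comp => //; exact: measurable_tuple_cons.
Qed.

Lemma measurable_tuple_cons_r (R : realType) (n : nat) (x : measurableTypeR R) :
  measurable_fun setT (fun v => @tuple_cons R n (x, v)).
Proof.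
by apply: (@measurable_cons _ _ _ _ (fun=> x) _ id) => //; exact: measurable_id.
Qed.

Lemma measurable_prode (R : realType) disp (X : measurableType disp) (n : nat)
    (f : 'I_n -> X -> \bar R) :
  (forall i, measurable_fun setT (f i)) ->
  measurable_fun setT (fun x => \prod_(i < n) f i x)%E.
Proof.
move=> mf; elim: n f mf => [|n IH] f mf.
  rewrite (_ : (fun _ => _) = cst 1%E)//.
  by apply/funext => x; rewrite big_ord0.
rewrite (_ : (fun _ => _) = fun x =>
    (f ord0 x * \prod_(i < n) f (lift ord0 i) x)%E); last first.
  by apply/funext => x; rewrite big_ord_recl.
by apply: emeasurable_funM => //; exact: IH.
Qed.

(** The only multidimensional integral that has to be bounded from above is
    dominated by a product of functions of one coordinate. *)
Lemma integral_tuple_prod (R : realType) (n : nat)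
    (phi : measurableTypeR R -> \bar R) :
  measurable_fun setT phi -> (forall x, 0 <= phi x)%E ->
  (\int[lebesgue_measure_tuple R n]_p \prod_(i < n) phi (tnth p i) =
   (\int[@lebesgue_measure R]_x phi x) ^+ n)%E.
Proof.
move=> mphi phi0; elim: n => [|n IH].
  under eq_integral do rewrite big_ord0.
  by rewrite integral_cst// mul1e/= diracT.
have m1 m : measurable_fun setT (fun v : m.-tuple (measurableTypeR R) =>
     \prod_(i < m) phi (tnth v i))%E.
  by apply: measurable_prode => i; apply: measurableT_comp => //; exact: measurable_tnth.
rewrite integral_tuple_cons//; last by move=> p; exact: prode_ge0.
under eq_integral => x _.
  under eq_integral => v _.
    rewrite big_ord_recl.
    rewrite [X in (X * _)%E](_ : _ = phi x); last by congr phi.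
    rewrite (eq_bigr (fun i => phi (tnth v i))); last first.
      by move=> i _; congr phi; rewrite (tnth_nth 0) [RHS](tnth_nth 0).
    over.
  rewrite ge0_integralZl//; last first.
  - by move=> *; exact: prode_ge0.
  - exact: m1.
  rewrite IH; over.
rewrite ge0_integralZr//.
  by rewrite expeS.
by apply: expe_ge0; exact: integral_ge0.
Qed.

Lemma measurable_integral_in2 (R : realType) (d1 d2 : measure_display)
    (T1 : measurableType d1) (T2 : measurableType d2)
    (m2 : {sigma_finite_measure set T2 -> \bar R})
    (B : set T2) (f : T1 * T2 -> \bar R) :
  measurable B -> measurable_fun setT f -> (forall z, 0 <= f z)%E ->
  measurable_fun setT (fun x => \int[m2]_(y in B) f (x, y))%E.
Proof.
move=> mB mf f0.
pose g := f \_ (setT `*` B).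
have mg : measurable_fun setT g.
  apply/(measurable_restrictT f (measurableX measurableT mB)).
  exact: measurable_funTS.
have g0 z : (0 <= g z)%E by rewrite /g patchE; case: ifP.
rewrite (_ : (fun _ => _) = fubini_F m2 g).
  exact: measurable_fun_fubini_tonelli_F.
apply/funext => x; rewrite integral_mkcond; apply: eq_integral => y _.
by rewrite /g !patchE in_setX in_setT.
Qed.

Lemma measurable_integral_in1 (R : realType) (d1 d2 : measure_display)
    (T1 : measurableType d1) (T2 : measurableType d2)
    (m1 : {sigma_finite_measure set T1 -> \bar R})
    (A : set T1) (f : T1 * T2 -> \bar R) :
  measurable A -> measurable_fun setT f -> (forall z, 0 <= f z)%E ->
  measurable_fun setT (fun y => \int[m1]_(x in A) f (x, y))%E.
Proof.
move=> mA mf f0.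
have := @measurable_integral_in2 _ _ _ T2 T1 m1 A (f \o (fun z => (z.2, z.1))) mA.
apply=> //; last by move=> z; exact: f0.
apply: measurableT_comp => //; exact: measurable_swap.
Qed.

(** Tonelli on a product of measurable sets, by extending the integrand by 0. *)
Lemma tonelli_in (R : realType) (d1 d2 : measure_display)
    (T1 : measurableType d1) (T2 : measurableType d2)
    (m1 : {sigma_finite_measure set T1 -> \bar R})
    (m2 : {sigma_finite_measure set T2 -> \bar R})
    (A : set T1) (B : set T2) (f : T1 * T2 -> \bar R) :
  measurable A -> measurable B -> measurable_fun setT f ->
  (forall z, 0 <= f z)%E ->
  (\int[m1]_(x in A) \int[m2]_(y in B) f (x, y) =
   \int[m2]_(y in B) \int[m1]_(x in A) f (x, y))%E.
Proof.
move=> mA mB mf f0.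
pose g := f \_ (A `*` B).
have mg : measurable_fun setT g.
  apply/(measurable_restrictT f (measurableX mA mB)).
  exact: measurable_funTS.
have gE x y : g (x, y) = if (x \in A) && (y \in B) then f (x, y) else 0%E.
  by rewrite /g patchE in_setX.
have g0 z : (0 <= g z)%E.
  by case: z => x y; rewrite gE; case: ifP.
have := @fubini_tonelli _ _ _ _ _ m1 m2 g mg g0.
rewrite [LHS](_ : _ = \int[m1]_(x in A) \int[m2]_(y in B) f (x, y))%E; last first.
  rewrite [RHS]integral_mkcond; apply: eq_integral => x _; rewrite patchE.
  case: ifPn => xA.
    rewrite [RHS]integral_mkcond; apply: eq_integral => y _.
    by rewrite gE xA patchE.
  by apply: integral0_eq => y _; rewrite gE (negbTE xA).
move=> ->.
rewrite [RHS]integral_mkcond; apply: eq_integral => y _; rewrite patchE.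
case: ifPn => yB.
  rewrite [RHS]integral_mkcond; apply: eq_integral => x _.
  by rewrite gE yB andbT patchE.
by apply: integral0_eq => x _; rewrite gE (negbTE yB) andbF.
Qed.

Lemma tnth_tuple_consS (R : realType) (n : nat) (x : R)
    (v : n.-tuple (measurableTypeR R)) (l : 'I_n) :
  tnth (tuple_cons (x, v)) (lift ord0 l) = tnth v l.
Proof. by rewrite (tnth_nth 0) [RHS](tnth_nth 0). Qed.

Definition cube (R : realType) (n : nat) (a b : R) :
    set (n.-tuple (measurableTypeR R)) :=
  [set p | forall i, a <= (tnth p i : R) <= b].

Lemma measurable_cube (R : realType) (n : nat) (a b : R) :
  measurable (@cube R n a b).
Proof.
rewrite (_ : cube a b = \bigcap_(i in [set: 'I_n]) ((@tnth n _)^~ i @^-1` `[a, b])).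
  apply: fin_bigcap_measurable => // i _.
  rewrite -[X in measurable X]setTI.
  exact: measurable_tnth.
apply/seteqP; split => [p pP i _ |p pP i] /=.
  by rewrite in_itv/=; exact: pP.
by have := pP i Logic.I; rewrite /= in_itv/=.
Qed.

Lemma cube_cons (R : realType) (n : nat) (a b x : R)
    (v : n.-tuple (measurableTypeR R)) :
  (tuple_cons (x, v) \in cube a b) = (x \in `[a, b]) && (v \in cube a b).
Proof.
apply/idP/andP => [/set_mem h|[xab /set_mem h]].
  split; first by rewrite in_itv/=; have := h ord0.
  apply/mem_set => i; have := h (lift ord0 i).
  by rewrite tnth_tuple_consS.
apply/mem_set => i; case: (unliftP ord0 i) => [j|] ->; last first.
  by move: xab; rewrite in_itv.
by rewrite tnth_tuple_consS; exact: h.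
Qed.

Lemma integral_cube_cons (R : realType) (n : nat) (a b : R)
    (f : n.+1.-tuple (measurableTypeR R) -> \bar R) :
  measurable_fun setT f -> (forall p, 0 <= f p)%E ->
  (\int[lebesgue_measure_tuple R n.+1]_(p in cube a b) f p =
   \int[@lebesgue_measure R]_(x in `[a, b])
     \int[lebesgue_measure_tuple R n]_(v in cube a b) f (tuple_cons (x, v)))%E.
Proof.
move=> mf f0; rewrite integral_mkcond integral_tuple_cons; last 2 first.
- apply/(measurable_restrictT f (@measurable_cube R n.+1 a b)).
  exact: measurable_funTS.
- by move=> p; rewrite patchE; case: ifP.
rewrite [RHS]integral_mkcond; apply: eq_integral => x _; rewrite patchE mem_setE.
case: ifPn => xA.
  rewrite [RHS]integral_mkcond; apply: eq_integral => y _.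
  by rewrite !patchE cube_cons xA.
by apply: integral0_eq => y _; rewrite patchE cube_cons (negbTE xA).
Qed.

Lemma lebesgue_measure_cube (R : realType) (n : nat) (a b : R) : a <= b ->
  lebesgue_measure_tuple R n (cube a b) = ((b - a) ^+ n)%:E.
Proof.
move=> ab.
elim: n => [|n IH].
  by rewrite /= diracE expr0 mem_set// => -[].
have : (\int[lebesgue_measure_tuple R n.+1]_(p in cube a b) 1)%E =
  lebesgue_measure_tuple R n.+1 (cube a b).
  by rewrite integral_cst ?mul1e//; exact: measurable_cube.
move=> <-; rewrite integral_cube_cons//.
under eq_integral => x _.
  rewrite integral_cst ?mul1e; last exact: measurable_cube.
  over.
rewrite integral_cst//= IH lebesgue_measure_itv/= lte_fin.
rewrite exprSr EFinM; case: ltgtP ab => // -> _.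
by rewrite subrr.
Qed.

Definition tuple_set (R : realType) (n : nat) (i : 'I_n) (x : R)
    (p : n.-tuple (measurableTypeR R)) : n.-tuple (measurableTypeR R) :=
  [tuple if j == i then x else tnth p j | j < n].

(** A lower bound holding on all slices parallel to one coordinate axis passes
    to the cube: the induction peels off the other coordinates, and Tonelli
    brings the chosen one inside once it comes first. *)
Lemma slice_le_cube (R : realType) (n : nat) (i : 'I_n) (a b c : R)
    (f : n.-tuple (measurableTypeR R) -> \bar R) :
  a <= b -> 0 <= c -> measurable_fun setT f -> (forall p, 0 <= f p)%E ->
  (forall p, cube a b p ->
    (c%:E <= \int[@lebesgue_measure R]_(x in `[a, b]) f (tuple_set i x p))%E) ->
  ((c * (b - a) ^+ n.-1)%:E <=
    \int[lebesgue_measure_tuple R n]_(p in cube a b) f p)%E.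
Proof.
move=> ab c0; elim: n i f => [[]//|n IH] i f mf f0 slice /=.
have aab : a \in `[a, b] by rewrite in_itv/= lexx ab.
have mfc : measurable_fun setT (f \o @tuple_cons R n).
  by apply: measurableT_comp => //; exact: measurable_tuple_cons.
rewrite integral_cube_cons//.
case: (unliftP ord0 i) => [j|] ij; last first.
  have /= -> := @tonelli_in _ _ _ _ _ (@lebesgue_measure R)
    (lebesgue_measure_tuple R n) `[a, b]%classic (@cube R n a b)
    (f \o @tuple_cons R n) (measurable_itv _) (@measurable_cube R n a b) mfc
    (fun z => f0 _).
  apply: (@le_trans _ _ (\int[lebesgue_measure_tuple R n]_(y in cube a b) c%:E)%E).
    rewrite integral_cst; last exact: measurable_cube.
    by rewrite /= lebesgue_measure_cube// EFinM.
  apply: ge0_le_integral => //.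
  - exact: measurable_cube.
  - apply: measurable_funTS.
    exact: (@measurable_integral_in1 _ _ _ _ _ (@lebesgue_measure R)
      `[a, b]%classic (f \o @tuple_cons R n) (measurable_itv _) mfc
      (fun z => f0 _)).
  - move=> v vab.
    have /slice : cube a b (tuple_cons (a, v)).
      by apply: set_mem; rewrite cube_cons aab mem_set.
    move=> /le_trans; apply; rewrite le_eqVlt; apply/orP; left; apply/eqP.
    apply: eq_integral => x _; congr f; apply: eq_from_tnth => k.
    rewrite tnth_mktuple ij; case: (unliftP ord0 k) => [l|] ->.
      by rewrite eq_sym (negbTE (neq_lift _ _)) !tnth_tuple_consS.
    by rewrite eqxx.
have [m nm] : exists m, n = m.+1.
  by exists n.-1; rewrite prednK// (leq_ltn_trans _ (ltn_ord j)).
subst n.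
rewrite exprSr mulrA EFinM.
apply: (@le_trans _ _ (\int[@lebesgue_measure R]_(x in `[a, b])
    (c * (b - a) ^+ m)%:E)%E).
  rewrite integral_cst// /= lebesgue_measure_itv/= lte_fin.
  by case: ltgtP ab => // -> _; rewrite subrr.
apply: ge0_le_integral => //.
- by move=> x _; rewrite lee_fin mulr_ge0// exprn_ge0// subr_ge0.
- apply: measurable_funTS.
  exact: (@measurable_integral_in2 _ _ _ _ _ (lebesgue_measure_tuple R m.+1)
    (@cube R m.+1 a b) (f \o @tuple_cons R m.+1) (@measurable_cube R m.+1 a b)
    mfc (fun z => f0 _)).
- move=> x xab; apply: (IH j (fun v => f (tuple_cons (x, v)))) => //.
    apply: measurableT_comp => //; exact: measurable_tuple_cons_r.
  move=> p pab.
  have /slice : cube a b (tuple_cons (x, p)).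
    by apply: set_mem; rewrite cube_cons mem_set// andbT.
  move=> /le_trans; apply; rewrite le_eqVlt; apply/orP; left; apply/eqP.
  apply: eq_integral => y _; congr f; apply: eq_from_tnth => k.
  rewrite tnth_mktuple ij; case: (unliftP ord0 k) => [l|] ->.
    by rewrite (inj_eq lift_inj) !tnth_tuple_consS tnth_mktuple.
  by rewrite (negbTE (neq_lift _ _)).
Qed.

(** * One-dimensional integrals *)

Lemma integral_FTC (R : realType) (f F : R -> R) (a b : R) :
  a < b -> {in `[a, b], forall x : R, is_derive x (1:R) F (f x)} ->
  {in `[a, b], forall x : R, {for x, continuous f}} ->
  (\int[@lebesgue_measure R]_(x in `[a, b]) (f x)%:E = (F b - F a)%:E)%E.
Proof.
move=> ab dF cf.
have cF : {in `[a, b], forall x : R, {for x, continuous F}}.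
  by move=> x /dF [dFx _]; apply/differentiable_continuous/derivable1_diffP.
have aab : a \in `[a, b] by rewrite in_itv/= lexx ltW.
have bab : b \in `[a, b] by rewrite in_itv/= lexx ltW.
rewrite (@continuous_FTC2 _ f F a b ab) ?EFinB//.
- by apply/continuous_in_subspaceT => x /set_mem xab; exact: cf.
- split.
  + by move=> x /subset_itv_oo_cc/dF [].
  + exact/cvg_at_right_filter/cF.
  + exact/cvg_at_left_filter/cF.
- by move=> x /subset_itv_oo_cc/dF [_ <-]; rewrite derive1E.
Qed.

(** Since [dg <= m], the integral of [sin (g x) ^+ 2] is at least [1 / m] times
    that of [dg x * sin (g x) ^+ 2], whose primitive is
    [(g - sin g cos g) / 2]; the second term of it oscillates by at most [1/2]
    at each end. *)
Lemma integral_sin2_ge (R : realType) (g dg : R -> R) (a b m : R) :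
  a < b -> 0 < m ->
  {in `[a, b], forall x : R, is_derive x (1:R) g (dg x)} ->
  {in `[a, b], forall x : R, {for x, continuous dg}} ->
  {in `[a, b], forall x : R, 0 <= dg x <= m} ->
  (((g b - g a - 1) / (2 * m))%:E <=
   \int[@lebesgue_measure R]_(x in `[a, b]) (sin (g x) ^+ 2)%:E)%E.
Proof.
move=> ab m0 dgE cdg dgm.
pose F x := (g x - sin (g x) * cos (g x)) / 2.
pose f x := dg x * sin (g x) ^+ 2.
have cg : {in `[a, b], forall x : R, {for x, continuous g}}.
  by move=> x /dgE [dFx _]; apply/differentiable_continuous/derivable1_diffP.
have csin : {in `[a, b], forall x : R, {for x, continuous (fun x => sin (g x) ^+ 2)}}.
  move=> x xab; apply: (@continuous_comp _ _ _ (sin \o g) (fun y => y ^+ 2)).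
    apply: continuous_comp; [exact: cg|exact: continuous_sin].
  exact: exprn_continuous.
have cf : {in `[a, b], forall x : R, {for x, continuous f}}.
  move=> x xab; apply: continuousM; [exact: cdg|exact: csin].
have dF : {in `[a, b], forall x : R, is_derive x (1:R) F (f x)}.
  move=> x xab; have dgx := dgE _ xab.
  have dsin : is_derive x (1:R) (sin \o g) (cos (g x) * dg x) by exact: is_derive1_comp.
  have dcos : is_derive x (1:R) (cos \o g) (- sin (g x) * dg x) by exact: is_derive1_comp.
  have dM := is_deriveM dsin dcos.
  have dB := is_deriveB dgx dM.
  have := is_deriveZ 2^-1 dB.
  rewrite (_ : 2^-1 \*: _ = F); last first.
    by apply/funext => y; rewrite /F [RHS]mulrC.
  move=> h; apply: (is_derive_eq h); rewrite /f /=.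
  have e : cos (g x) ^+ 2 = 1 - sin (g x) ^+ 2.
    by rewrite -(cos2Dsin2 (g x)) addrK.
  transitivity (2^-1 * dg x * (1 + sin (g x) ^+ 2 - cos (g x) ^+ 2)).
    by rewrite /GRing.scale/=; ring.
  by rewrite e; field.
have ff0 : forall x, x \in `[a, b] -> 0 <= f x.
  by move=> x /dgm /andP[? _]; rewrite mulr_ge0 ?sqr_ge0.
have mon (h : R -> R) : {in `[a, b], forall x : R, {for x, continuous h}} ->
    measurable_fun `[a, b] (EFin \o h).
  move=> ch; apply/measurable_EFinP; apply: subspace_continuous_measurable_fun => //.
  by apply/continuous_in_subspaceT => x /set_mem xab; exact: ch.
have sub1 : (\int[@lebesgue_measure R]_(x in `[a, b]) (f x)%:E <=
   m%:E * \int[@lebesgue_measure R]_(x in `[a, b]) (sin (g x) ^+ 2)%:E)%E.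
  rewrite -ge0_integralZl_EFin//; last 3 first.
  - by move=> x _; rewrite lee_fin sqr_ge0.
  - exact: mon.
  - exact: ltW.
  apply: ge0_le_integral => //.
  - exact: mon.
  - by apply: measurable_funeM; exact: mon.
  - move=> x xab; rewrite -EFinM lee_fin ler_wpM2r ?sqr_ge0//.
    by have /andP[] := dgm _ xab.
have := integral_FTC ab dF cf.
move: sub1 => /[swap] ->.
case: (\int[_]_(x in _) _)%E => [r||]; last 2 first.
- by rewrite leey.
- by rewrite gt0_muleNy ?lte_fin// leNye.
rewrite -EFinM !lee_fin ler_pdivrMr ?mulr_gt0// /F => h.
have sc y : `|sin y * cos y| <= 1 / 2 :> R.
  rewrite ler_norml; have := cos2Dsin2 y => e.
  have := sqr_ge0 (sin y - cos y); have := sqr_ge0 (sin y + cos y).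
  move=> ? ?; apply/andP; split; nra.
have := sc (g b); have := sc (g a); rewrite !ler_norml => /andP[? ?] /andP[? ?].
lra.
Qed.

Lemma integral_bigcup_le (R : realType) d (X : measurableType d)
    (mu : {measure set X -> \bar R}) (F : (set X)^nat) (f : X -> \bar R)
    (B : \bar R) :
  nondecreasing_seq F -> (forall i, measurable (F i)) ->
  measurable_fun setT f -> (forall x, 0 <= f x)%E ->
  (forall i, \int[mu]_(x in F i) f x <= B)%E ->
  (\int[mu]_(x in \bigcup_i F i) f x <= B)%E.
Proof.
move=> ndF mF mf f0 FB.
have := @ge0_nondecreasing_set_cvg_integral _ _ _ F f mu ndF mF.
move=> /(_ (fun i => measurable_funTS mf) (fun i x _ => f0 x)) h.
rewrite -(cvg_lim _ h)//; apply: lime_le; first by apply/cvg_ex; eexists; exact: h.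
by apply: nearW => n; exact: FB.
Qed.

Lemma integral_powR_itv (R : realType) (r a b : R) : r != 0 -> 0 < a -> a < b ->
  (\int[@lebesgue_measure R]_(x in `[a, b]) (x `^ (r - 1))%:E =
    (b `^ r / r - a `^ r / r)%:E)%E.
Proof.
move=> r0 a0 ab.
have pos (x : R) : x \in `[a, b] -> 0 < x.
  by rewrite in_itv/= => /andP[ax _]; exact: lt_le_trans ax.
apply: (@integral_FTC _ (fun x => x `^ (r - 1)) (fun x => x `^ r / r)) => //.
- move=> x /pos x0.
  have := is_deriveZ r^-1 (is_derive1_powR r x0).
  rewrite (_ : r^-1 \*: _ = (fun x => x `^ r / r)); last first.
    by apply/funext => y; rewrite [RHS]mulrC.
  by move=> h; apply: (is_derive_eq h); rewrite /GRing.scale/= mulKf.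
- move=> x /pos x0; have [d _] := is_derive1_powR (r - 1) x0.
  exact/differentiable_continuous/derivable1_diffP.
Qed.

Lemma integral_powR_near0 (R : realType) (p c : R) : 0 < p -> 0 < c ->
  (\int[@lebesgue_measure R]_(x in `]0%R, c]) (x `^ (p - 1))%:E <=
    (c `^ p / p)%:E)%E.
Proof.
move=> p0 c0.
have -> : `]0%R, c]%classic = \bigcup_n `[c / n.+2%:R, c]%classic :> set R.
  apply/seteqP; split => [x|x [n _]]/=; rewrite !in_itv/=; last first.
    by move=> /andP[cx ->]; rewrite andbT; apply: lt_le_trans cx; exact: divr_gt0.
  move=> /andP[x0 xc]; exists (Num.trunc (c / x)) => //=.
  rewrite in_itv/= xc andbT ler_pdivrMr// mulrC -ler_pdivrMr//.
  have := truncnS_gt (c / x) => /ltW/le_trans; apply.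
  by rewrite ler_nat.
apply: integral_bigcup_le => //.
- move=> m n mn; apply/subsetPset => x /=; rewrite !in_itv/= => /andP[cx ->].
  rewrite andbT; apply: le_trans cx.
  by rewrite ler_pM2l// lef_pV2 ?posrE// ler_nat !ltnS.
- by apply/measurable_EFinP; exact: measurable_powR.
- by move=> x; rewrite lee_fin powR_ge0.
move=> n; rewrite integral_powR_itv ?gt_eqF// ?divr_gt0//; last first.
  by rewrite ltr_pdivrMr// ltr_pMr// ltr1n.
by rewrite lee_fin gerBl// divr_ge0 ?powR_ge0// ltW.
Qed.

Lemma integral_powR_pinfty (R : realType) (q c : R) : 0 < q -> 0 < c ->
  (\int[@lebesgue_measure R]_(x in `]c, +oo[) (x `^ (- q - 1))%:E <=
    (c `^ (- q) / q)%:E)%E.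
Proof.
move=> q0 c0.
have -> : `]c, +oo[%classic = \bigcup_n `[c + n.+1%:R^-1, c + n.+1%:R]%classic :> set R.
  apply/seteqP; split => [x|x [n _]]/=; rewrite !in_itv/= ?andbT; last first.
    by move=> /andP[cx _]; apply: lt_le_trans cx; rewrite ltrDl.
  move=> cx; have xc0 : 0 < x - c by rewrite subr_gt0.
  exists (Num.trunc (Num.max (x - c) (x - c)^-1)) => //=.
  rewrite in_itv/= -lerBrDl -[in X in _ && X]lerBlDl; apply/andP; split.
    rewrite -[leRHS]invrK lef_pV2 ?posrE ?invr_gt0//.
    apply: le_trans (ltW (truncnS_gt (Num.max (x - c) (x - c)^-1))).
    by rewrite le_max lexx orbT.
  apply: le_trans (ltW (truncnS_gt (Num.max (x - c) (x - c)^-1))).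
  by rewrite le_max lexx.
apply: integral_bigcup_le => //.
- move=> m n mn; apply/subsetPset => x /=; rewrite !in_itv/= => /andP[cx xc].
  apply/andP; split.
    by apply: le_trans cx; rewrite lerD2l lef_pV2 ?posrE// ler_nat ltnS.
  by apply: le_trans xc _; rewrite lerD2l ler_nat.
- by apply/measurable_EFinP; exact: measurable_powR.
- by move=> x; rewrite lee_fin powR_ge0.
move=> n.
have [n0|n0] := posnP n.
  by rewrite n0 invr1 set_itv1 integral_set1 lee_fin divr_ge0 ?powR_ge0// ltW.
have cn0 : 0 < c + n.+1%:R^-1 by rewrite addr_gt0.
rewrite integral_powR_itv ?oppr_eq0 ?gt_eqF//; last first.
  rewrite ltrD2l (@lt_trans _ _ 1) ?ltr1n//.
  by rewrite invf_lt1// ltr1n.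
rewrite lee_fin invrN !mulrN opprK addrC.
apply: (@le_trans _ _ ((c + n.+1%:R^-1) `^ (- q) / q)).
  by rewrite gerBl// divr_ge0 ?powR_ge0// ltW.
rewrite ler_pM2r ?invr_gt0// !powRN lef_pV2 ?posrE ?powR_gt0//.
by rewrite ge0_ler_powR ?nnegrE ?ltW// ltrDl.
Qed.

(** * Integral of the dominating radial profile *)

(** Every spectral integrand of an increment of size [a] is dominated by a
    multiple of this function of [l = |xi|], with [e = beta - k]: an increment
    of [sin (t l) / l] is at most [a] and at most a multiple of [1 / l]. *)
Definition profile (R : realType) (e a l : R) : R :=
  l `^ e * Num.min a l^-1 ^+ 2.

Lemma profile_ge0 (R : realType) (e a l : R) : 0 <= profile e a l.
Proof. by rewrite mulr_ge0 ?powR_ge0 ?sqr_ge0. Qed.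

Lemma profile_gt0 (R : realType) (e a l : R) :
  0 < a -> 0 < l -> 0 < profile e a l.
Proof.
move=> a0 l0; rewrite mulr_gt0 ?powR_gt0 ?exprn_gt0//.
by rewrite lt_min a0 invr_gt0.
Qed.

Lemma powR_nonincreasing (R : realType) (e x y : R) : e <= 0 -> 0 < x ->
  x <= y -> y `^ e <= x `^ e.
Proof.
move=> e0 x0 xy; have y0 := lt_le_trans x0 xy.
rewrite -(opprK e) !(powRN _ (- e)) lef_pV2 ?posrE ?powR_gt0//.
by rewrite ge0_ler_powR ?oppr_ge0// nnegrE ltW.
Qed.

Lemma profile_nonincreasing (R : realType) (e a x y : R) :
  e <= 0 -> 0 < a -> 0 < x -> x <= y -> profile e a y <= profile e a x.
Proof.
move=> e0 a0 x0 xy; have y0 := lt_le_trans x0 xy.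
have my : 0 <= Num.min a y^-1 by rewrite le_min ltW//= invr_ge0 ltW.
apply: ler_pM; [exact: powR_ge0|exact: sqr_ge0|exact: powR_nonincreasing|].
rewrite ler_sqr ?nnegrE//; last by rewrite le_min ltW//= invr_ge0 ltW.
by rewrite le_min !ge_min lexx/= lef_pV2 ?posrE// xy orbT.
Qed.

(** The [k]-th root makes the product of [k] of these comparable to [profile].
    The value at 0 is [+oo] because real powers send 0 to 0 while [profile]
    is positive off the origin, in particular on the coordinate hyperplanes. *)
Definition coord_profile (R : realType) (k : nat) (e a : R)
    (x : measurableTypeR R) : \bar R :=
  if (x : R) == 0 then +oo%E else (profile e a `|x : R| `^ k%:R^-1)%:E.

(** [x^-1] is written through a real power of [x ^+ 2], which is nonnegative. *)
Lemma measurable_invr (R : realType) : measurable_fun [set: measurableTypeR R] (@GRing.inv R).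
Proof.
rewrite (_ : GRing.inv = (fun x : R => x * (x ^+ 2) `^ (-1))).
  apply: measurable_funM => //; apply: (measurableT_comp (measurable_powR _)).
  exact: exprn_measurable.
apply/funext => x; rewrite powR_inv1 ?sqr_ge0//.
have [->|x0] := eqVneq x 0; first by rewrite invr0 mul0r.
by rewrite expr2 invfM mulrA divff// mul1r.
Qed.

Lemma measurable_profile (R : realType) (e a : R) :
  measurable_fun [set: measurableTypeR R] (profile e a).
Proof.
apply: measurable_funM; first exact: measurable_powR.
apply: measurable_funX; apply: measurable_minr => //.
exact: measurable_invr.
Qed.

Lemma measurable_coord_profile (R : realType) (k : nat) (e a : R) :
  measurable_fun [set: measurableTypeR R] (coord_profile k e a).
Proof.
apply: measurable_fun_ifT => //.
  exact: measurable_fun_eqr.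
apply/measurable_EFinP; apply: (measurableT_comp (measurable_powR _)).
apply: (measurableT_comp (measurable_profile _ _)); exact: normr_measurable.
Qed.

Lemma coord_profile_ge0 (R : realType) (k : nat) (e a x : R) :
  (0 <= coord_profile k e a x)%E.
Proof. by rewrite /coord_profile; case: ifP => // _; rewrite lee_fin powR_ge0. Qed.

Lemma coord_profile_gt0 (R : realType) (k : nat) (e a x : R) : 0 < a ->
  (0 < coord_profile k e a x)%E.
Proof.
move=> a0; rewrite /coord_profile; case: eqP => // /eqP x0.
by rewrite lte_fin powR_gt0// profile_gt0// normr_gt0.
Qed.

Lemma coord_le_enorm (R : realType) (k : nat) (x : 'rV[R]_k) (i : 'I_k) :
  `|x 0 i| <= enorm x.
Proof.
rewrite -sqrtr_sqr ler_wsqrtr// /dotp (bigD1 i)//= -expr2 lerDl.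
by rewrite sumr_ge0// => j _; rewrite -expr2 sqr_ge0.
Qed.

(** [profile] is nonincreasing in the radius and each coordinate is bounded by
    the Euclidean norm, so [profile |xi|] is below each [profile |xi_i|], hence
    below their geometric mean. This replaces polar coordinates. *)
Lemma profile_le_prod (R : realType) (k : nat) (e a : R)
    (p : k.-tuple (measurableTypeR R)) : (0 < k)%N -> e <= 0 -> 0 < a ->
  ((profile e a (enorm (row_of_tuple p)))%:E <=
    \prod_(i < k) coord_profile k e a (tnth p i))%E.
Proof.
move=> k0 e0 a0.
have [[i pi0]|pn0] := pselect (exists i, (tnth p i : R) = 0).
  rewrite (bigD1 i)//= {1}/coord_profile pi0 eqxx gt0_mulye ?leey//.
  by elim/big_ind : _ => // [x y x0 y0|j _]; [exact: mule_gt0|exact: coord_profile_gt0].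
have pn i : (tnth p i : R) != 0 by apply/eqP => pi; apply: pn0; exists i.
rewrite (eq_bigr (fun i => (profile e a `|tnth p i : R| `^ k%:R^-1)%:E)); last first.
  by move=> i _; rewrite /coord_profile (negbTE (pn i)).
rewrite prodEFin lee_fin.
set l := enorm _.
apply: (@le_trans _ _ (\prod_(i < k) (profile e a l `^ k%:R^-1))).
  rewrite prodr_const card_ord -powR_mulrn ?powR_ge0// -powRrM mulVf ?powRr1 ?profile_ge0//.
  by rewrite pnatr_eq0 -lt0n.
apply: ler_prod => i _; rewrite powR_ge0/=.
rewrite ge0_ler_powR ?nnegrE ?invr_ge0 ?ler0n ?profile_ge0//.
apply: profile_nonincreasing => //; first by rewrite normr_gt0.
by have := coord_le_enorm (row_of_tuple p) i; rewrite mxE.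
Qed.

Lemma sqr_min_lel (R : realType) (x y : R) : 0 <= x -> 0 <= y ->
  Num.min x y ^+ 2 <= x ^+ 2.
Proof.
move=> x0 y0; have m0 : 0 <= Num.min x y by rewrite le_min x0.
by rewrite ler_sqr ?nnegrE// ge_min lexx.
Qed.

Lemma sqr_min_ler (R : realType) (x y : R) : 0 <= x -> 0 <= y ->
  Num.min x y ^+ 2 <= y ^+ 2.
Proof. by move=> x0 y0; rewrite minC sqr_min_lel. Qed.

Lemma powRV (R : realType) (a x : R) : 0 <= a -> a^-1 `^ x = a `^ (- x).
Proof. by move=> a0; rewrite -powR_inv1// -powRrM mulN1r. Qed.

(** The integrand is [a ^ (2/k) x ^ (b/k - 1)] at most on [0 < x <= 1/a] and
    [x ^ (- (2 - b)/k - 1)] at most beyond; both powers are integrable exactly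
    because [0 < b < 2], and both give the same power of [a]. *)
Lemma integral_coord_profile (R : realType) (k : nat) (b a : R) :
  (0 < k)%N -> 0 < b -> b < 2 -> 0 < a ->
  (\int[@lebesgue_measure R]_x coord_profile k (b - k%:R) a x <=
   (2 * ((k%:R / b + k%:R / (2 - b)) * a `^ ((2 - b) / k%:R)))%:E)%E.
Proof.
move=> k0 b0 b2 a0.
set phi := coord_profile k (b - k%:R) a.
have mphi : measurable_fun setT phi by exact: measurable_coord_profile.
have phi0 x : (0 <= phi x)%E by exact: coord_profile_ge0.
have kR : 0 < k%:R :> R by rewrite ltr0n.
have kN : k%:R != 0 :> R by rewrite gt_eqF.
have aN : a != 0 by rewrite gt_eqF.
(* the factor [Num.min a x^-1] is bounded by [a] near 0 and by [x^-1] near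
   infinity; the two bounds meet at [x = a^-1] *)
have near0 x : 0 < x -> (phi x <=
    (a `^ (2 / k%:R))%:E * (x `^ (b / k%:R - 1))%:E)%E.
  move=> x0; rewrite /phi /coord_profile gt_eqF// gtr0_norm// -EFinM lee_fin.
  rewrite /profile powRM ?powR_ge0 ?sqr_ge0// mulrC -powRrM mulrBl divff//.
  rewrite ler_wpM2r ?powR_ge0//.
  rewrite powRrM powR_mulrn ?(ltW a0)// ge0_ler_powR ?nnegrE ?sqr_ge0 ?invr_ge0 ?ler0n//.
  by apply: sqr_min_lel; rewrite ?invr_ge0 ltW.
have neary x : 0 < x -> (phi x <= (x `^ (- ((2 - b) / k%:R) - 1))%:E)%E.
  move=> x0; rewrite /phi /coord_profile gt_eqF// gtr0_norm// lee_fin.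
  rewrite (_ : - _ - 1 = (b - k%:R - 2) / k%:R); last by field.
  rewrite powRrM ge0_ler_powR ?nnegrE ?profile_ge0 ?powR_ge0 ?invr_ge0 ?ler0n//.
  rewrite /profile [leRHS]powRD; last by rewrite (gt_eqF x0) implybT.
  rewrite ler_wpM2l ?powR_ge0// powR_invn ?(ltW x0)// -exprVn.
  by apply: sqr_min_ler; rewrite ?invr_ge0 ltW.
have half : (\int[@lebesgue_measure R]_(x in `]0%R, +oo[) phi x <=
    ((k%:R / b + k%:R / (2 - b)) * a `^ ((2 - b) / k%:R))%:E)%E.
  have -> : `]0%R, +oo[%classic = `]0%R, a^-1] `|` `]a^-1, +oo[ :> set R.
    by rewrite -itv_bndbnd_setU// bnd_simp invr_ge0 ltW.
  rewrite ge0_integral_setU//=; last 2 first.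
  - exact: measurable_funTS.
  - apply/disj_setPS => x [] /=; rewrite !in_itv/= andbT => /andP[_ xa] ax.
    by have := lt_le_trans ax xa; rewrite ltxx.
  rewrite mulrDl EFinD; apply: leeD.
    apply: (@le_trans _ _ (\int[@lebesgue_measure R]_(x in `]0%R, a^-1%R])
      ((a `^ (2 / k%:R))%:E * (x `^ (b / k%:R - 1))%:E))%E).
      apply: ge0_le_integral => //.
      - exact: measurable_funTS.
      - apply: measurable_funeM; apply: measurable_funTS; apply/measurable_EFinP.
        exact: measurable_powR.
      - by move=> x; rewrite /= in_itv/= => /andP[x0 _]; exact: near0.
    rewrite ge0_integralZl_EFin//; last 3 first.
    - by move=> x _; rewrite lee_fin powR_ge0.
    - by apply: measurable_funTS; apply/measurable_EFinP; exact: measurable_powR.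
    - exact: powR_ge0.
    apply: (@le_trans _ _ ((a `^ (2 / k%:R))%:E *
        (a^-1 `^ (b / k%:R) / (b / k%:R))%:E)%E).
      apply: lee_wpmul2l; first by rewrite lee_fin powR_ge0.
      by apply: integral_powR_near0; rewrite ?divr_gt0// invr_gt0.
    rewrite -EFinM lee_fin powRV ?(ltW a0)//.
    rewrite [leRHS](_ : _ = k%:R / b * (a `^ (2 / k%:R) * a `^ (- (b / k%:R)))).
      by rewrite le_eqVlt; apply/orP; left; apply/eqP; field; rewrite kN gt_eqF.
    rewrite -powRD; last by rewrite aN implybT.
    by congr (_ * _ `^ _); field.
  apply: (@le_trans _ _ (\int[@lebesgue_measure R]_(x in `]a^-1%R, +oo[)
      (x `^ (- ((2 - b) / k%:R) - 1))%:E)%E).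
    apply: ge0_le_integral => //.
    - exact: measurable_funTS.
    - by apply: measurable_funTS; apply/measurable_EFinP; exact: measurable_powR.
    - move=> x; rewrite /= in_itv/= andbT => ax; apply: neary.
      by apply: lt_trans ax; rewrite invr_gt0.
  apply: (le_trans (integral_powR_pinfty _ _)).
  - by rewrite divr_gt0// subr_gt0.
  - by rewrite invr_gt0.
  rewrite lee_fin powRV ?(ltW a0)// opprK invf_div mulrC.
  by [].
have symm : (\int[@lebesgue_measure R]_x phi x =
   2%:E * \int[@lebesgue_measure R]_(x in `]0%R, +oo[) phi x)%E.
  rewrite (_ : [set: measurableTypeR R] =
      `]-oo, 0%R]%classic `|` `]0%R, +oo[%classic :> set R); last first.
    by rewrite -itv_bndbnd_setU// set_itvNyy.
  rewrite ge0_integral_setU//=; last 2 first.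
  - exact: measurable_funTS.
  - apply/disj_setPS => x [] /=; rewrite !in_itv/= andbT => xa ax.
    by have := lt_le_trans ax xa; rewrite ltxx.
  have even (r : R) : phi (- r) = phi r.
    by rewrite /phi /coord_profile oppr_eq0 normrN.
  have neg : (\int[@lebesgue_measure R]_(x in `]-oo, 0%R]) phi x =
      \int[@lebesgue_measure R]_(x in `]0%R, +oo[) phi x)%E.
    rewrite integral_itv_obnd_cbnd; last exact: measurable_funTS.
    rewrite (ge0_integration_by_substitution0 mphi phi0).
    by apply: eq_integral => x _; rewrite even.
  by rewrite neg -[2%R]/(1 + 1)%R EFinD ge0_muleDl// mul1e.
rewrite symm EFinM; exact: lee_wpmul2l.
Qed.

Lemma measurable_row_tuple (R : realType) (k : nat) (i : 'I_k) :
  measurable_fun setT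
    (fun p : k.-tuple (measurableTypeR R) => (row_of_tuple p 0 i : measurableTypeR R)).
Proof.
rewrite (_ : (fun _ => _) = (@tnth k (measurableTypeR R))^~ i); last first.
  by apply/funext => p; rewrite mxE.
exact: measurable_tnth.
Qed.

Lemma measurable_dotp_tuple (R : realType) (k : nat) (z : 'rV[R]_k) :
  measurable_fun setT
    (fun p : k.-tuple (measurableTypeR R) => (dotp (row_of_tuple p) z : measurableTypeR R)).
Proof.
rewrite /dotp; apply: measurable_sum => i.
by apply: measurable_funM => //; exact: measurable_row_tuple.
Qed.

Lemma measurable_enorm_tuple (R : realType) (k : nat) :
  measurable_fun setT
    (fun p : k.-tuple (measurableTypeR R) => (enorm (row_of_tuple p) : measurableTypeR R)).
Proof.
apply: (@measurableT_comp _ _ _ _ _ _ (@Num.sqrt R)).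
  by apply: continuous_measurable_fun; exact: sqrt_continuous.
rewrite /dotp; apply: measurable_sum => i.
by apply: measurable_funM => //; exact: measurable_row_tuple.
Qed.

(** Taking the [k]-th power of the one-dimensional bound restores the exponent
    [2 - b]. *)
Lemma integral_profile (R : realType) (k : nat) (b a : R) :
  (0 < k)%N -> 0 < b -> b < 2 -> b < k%:R -> 0 < a ->
  (\int[lebesgue_measure_tuple R k]_p
     (profile (b - k%:R) a (enorm (row_of_tuple p)))%:E <=
   ((2 * (k%:R / b + k%:R / (2 - b))) ^+ k * a `^ (2 - b))%:E)%E.
Proof.
move=> k0 b0 b2 bk a0.
apply: (@le_trans _ _ (\int[lebesgue_measure_tuple R k]_p
    \prod_(i < k) coord_profile k (b - k%:R) a (tnth p i))%E).
  apply: ge0_le_integral => //.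
  - by move=> p _; rewrite lee_fin profile_ge0.
  - apply/measurable_EFinP; apply: (measurableT_comp (measurable_profile _ _)).
    exact: measurable_enorm_tuple.
  - apply: measurable_prode => i; apply: measurableT_comp.
      exact: measurable_coord_profile.
    exact: measurable_tnth.
  - by move=> p _; apply: profile_le_prod => //; rewrite subr_le0 ltW.
rewrite integral_tuple_prod; last 2 first.
- exact: measurable_coord_profile.
- by move=> x; exact: coord_profile_ge0.
have := integral_coord_profile k0 b0 b2 a0.
have : (0 <= \int[@lebesgue_measure R]_x coord_profile k (b - k%:R) a x)%E.
  by apply: integral_ge0 => x _; exact: coord_profile_ge0.
case: (\int[_]_x _)%E => [r|//|//].
rewrite !lee_fin => r0 rle; rewrite -EFin_expe lee_fin.
apply: (le_trans (lerXn2r k _ _ rle)); rewrite ?nnegrE//.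
  exact: le_trans rle.
rewrite mulrA exprMn -(powR_mulrn k (powR_ge0 _ _)) -powRrM divfK//.
by rewrite pnatr_eq0 -lt0n.
Qed.

(** * Pointwise estimates in Fourier space *)

Lemma norm_sinB_le (R : realType) (x y : R) : `|sin x - sin y| <= `|x - y|.
Proof.
wlog yx : x y / y <= x.
  by move=> h; have [/h//|/ltW/h] := leP y x; rewrite distrC (distrC x).
have csin : {within `[y, x], continuous (@sin R)}.
  by apply/continuous_subspaceT => z; exact: continuous_sin.
have [c _ ->] := MVT_segment yx (fun z _ => is_derive_sin z) csin.
by rewrite normrM ler_piMl// cos_max.
Qed.

Lemma norm_sin_le (R : realType) (x : R) : `|sin x| <= `|x|.
Proof. by have := norm_sinB_le x 0; rewrite sin0 !subr0. Qed.

Lemma one_minus_cos_le (R : realType) (x : R) : 1 - cos x <= x ^+ 2 / 2.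
Proof.
have -> : cos x = 1 - 2 * sin (x / 2) ^+ 2.
  rewrite [in LHS](_ : x = x / 2 + x / 2); last by field.
  by rewrite cosD -!expr2 cos2sin2; ring.
have : sin (x / 2) ^+ 2 <= (x / 2) ^+ 2.
  by rewrite -(real_normK (num_real (sin _))) -(real_normK (num_real (x / 2)))
    ler_sqr ?nnegrE// norm_sin_le.
lra.
Qed.

(** The left-hand side is [|e^(i th) sin a - sin b|^2] when [p = cos th]. On the
    right [a - b] does not depend on the time integrated out while [a + b]
    does, which separates the mean from the oscillation. *)
Lemma sin_quadratic (R : realType) (a b p : R) :
  sin a ^+ 2 + sin b ^+ 2 - 2 * p * (sin a * sin b) =
  1 - p * cos (a - b) + (p - cos (a - b)) * cos (a + b).
Proof.
rewrite cosB cosD.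
have ha := cos2sin2 a; have hb := cos2sin2 b.
have hab : cos a * cos b * (cos a * cos b) =
  (1 - sin a ^+ 2) * (1 - sin b ^+ 2) by rewrite -ha -hb; ring.
ring: hab.
Qed.

(** At [xi = 0] both sides vanish thanks to the convention [0^-1 = 0]. *)
Lemma norm_FG_le (R : realType) (k : nat) (t : R) (xi : 'rV[R]_k) :
  `|FG t xi| <= Num.min `|t| (enorm xi)^-1.
Proof.
have l0 : 0 <= enorm xi by exact: sqrtr_ge0.
rewrite /FG normrM normfV (ger0_norm l0).
have [->|ln] := eqVneq (enorm xi) 0.
  by rewrite invr0 mulr0 le_min normr_ge0 lexx.
have lp : 0 < enorm xi by rewrite lt_neqAle eq_sym ln.
rewrite le_min ler_pdivrMr//; apply/andP; split.
  by rewrite -{2}(ger0_norm l0) -normrM norm_sin_le.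
by rewrite ler_piMl ?invr_ge0// sin_max.
Qed.

(** Beyond the frequency [1 / a] both values of [FG] are at most
    [(enorm xi)^-1]. Below it the form is split into the squared time
    increment, at most [a ^+ 2] as [sin] is 1-Lipschitz, and a phase term
    controlled by [1 - cos th <= th ^+ 2 / 2]. *)
Lemma FG_quadratic_le (R : realType) (k : nat) (a t s th z K : R) (xi : 'rV[R]_k) :
  0 <= z -> z <= a -> `|t - s| <= a -> `|th| <= K * (enorm xi * z) ->
  FG t xi ^+ 2 + FG s xi ^+ 2 - 2 * cos th * (FG t xi * FG s xi) <=
  (4 + K ^+ 2) * Num.min a (enorm xi)^-1 ^+ 2.
Proof.
move=> z0 za tsa thK.
have l0 : 0 <= enorm xi by exact: sqrtr_ge0.
have a0 : 0 <= a by exact: le_trans za.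
have := norm_FG_le t xi; have := norm_FG_le s xi; rewrite !le_min.
move=> /andP[_ sl] /andP[_ tl].
have {sl} sl : FG s xi ^+ 2 <= (enorm xi)^-1 ^+ 2.
  by rewrite -(real_normK (num_real (FG s xi))) ler_sqr ?nnegrE// invr_ge0.
have {tl} tl : FG t xi ^+ 2 <= (enorm xi)^-1 ^+ 2.
  by rewrite -(real_normK (num_real (FG t xi))) ler_sqr ?nnegrE// invr_ge0.
have c1 := cos_le1 th; have c2 := cos_geN1 th.
have K0 := sqr_ge0 K.
(* the minimum is [(enorm xi)^-1] in the first case and [a] in the second *)
case: (leP a (enorm xi)^-1) => al; last first.
  have h : FG t xi ^+ 2 + FG s xi ^+ 2 - 2 * cos th * (FG t xi * FG s xi) <=
      2 * FG t xi ^+ 2 + 2 * FG s xi ^+ 2.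
    have := sqr_ge0 (FG t xi + cos th * FG s xi).
    have : cos th ^+ 2 <= 1 by nra.
    have := sqr_ge0 (FG s xi); nra.
  have := sqr_ge0 (enorm xi)^-1; nra.
have [l00|ln] := eqVneq (enorm xi) 0.
  rewrite /FG l00 invr0 !(mulr0, mul0r) expr0n/= ?(mulr0, mul0r) subr0 addr0.
  by rewrite mulr_ge0 ?sqr_ge0// addr_ge0.
have lp : 0 < enorm xi by rewrite lt_neqAle eq_sym ln.
have dif : (FG t xi - FG s xi) ^+ 2 <= a ^+ 2.
  rewrite -(real_normK (num_real (_ - _))) ler_sqr ?nnegrE//.
  rewrite /FG -mulrBl normrM normfV (ger0_norm l0) ler_pdivrMr//.
  apply: (le_trans (norm_sinB_le _ _)).
  by rewrite -mulrBl normrM (ger0_norm l0) ler_wpM2r.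
have cp : 2 * (1 - cos th) * (FG t xi * FG s xi) <= K ^+ 2 * a ^+ 2.
  have ts : FG t xi * FG s xi <= (enorm xi)^-1 ^+ 2.
    have := sqr_ge0 (FG t xi - FG s xi); nra.
  apply: (@le_trans _ _ (th ^+ 2 * (enorm xi)^-1 ^+ 2)).
    apply: (@le_trans _ _ (2 * (1 - cos th) * (enorm xi)^-1 ^+ 2)).
      by rewrite ler_wpM2l//; lra.
    by rewrite ler_wpM2r ?sqr_ge0//; have := one_minus_cos_le th; lra.
  have -> : K ^+ 2 * a ^+ 2 = (K * (enorm xi * a)) ^+ 2 * (enorm xi)^-1 ^+ 2.
    by field.
  rewrite ler_wpM2r ?sqr_ge0// -(real_normK (num_real th)).
  have {}thK : `|th| <= `|K * (enorm xi * z)| by exact: le_trans (ler_norm _).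
  apply: (@le_trans _ _ (`|K * (enorm xi * z)| ^+ 2)).
    by rewrite ler_sqr ?nnegrE.
  rewrite real_normK ?num_real// !exprMn ler_wpM2l// ler_wpM2l ?sqr_ge0//.
  by rewrite ler_sqr ?nnegrE.
have -> : FG t xi ^+ 2 + FG s xi ^+ 2 - 2 * cos th * (FG t xi * FG s xi) =
  (FG t xi - FG s xi) ^+ 2 + 2 * (1 - cos th) * (FG t xi * FG s xi) by ring.
have := sqr_ge0 a; nra.
Qed.

(** A crude form of Cauchy-Schwarz, enough up to constants. *)
Lemma norm_dotp_le (R : realType) (k : nat) (x z : 'rV[R]_k) :
  `|dotp x z| <= k%:R * (enorm x * enorm z).
Proof.
apply: (le_trans (ler_norm_sum _ _ _)).
apply: (@le_trans _ _ (\sum_(i < k) (enorm x * enorm z))).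
  by apply: ler_sum => i _; rewrite normrM ler_pM ?coord_le_enorm.
by rewrite sumr_const card_ord mulr_natl.
Qed.

(** * From the random field to its covariance kernel *)

(** The product [f g] is integrable because it is dominated by [f^2 + g^2]. *)
Lemma integral_sqrB (R : realType) (d : measure_display) (X : measurableType d)
    (mu : {measure set X -> \bar R}) (f g : X -> R) (a b c : R) :
  measurable_fun setT f -> measurable_fun setT g ->
  (\int[mu]_w (f w * f w)%:E = a%:E)%E ->
  (\int[mu]_w (g w * g w)%:E = b%:E)%E ->
  (\int[mu]_w (f w * g w)%:E = c%:E)%E ->
  (\int[mu]_w ((f w - g w) ^+ 2)%:E = (a + b - 2 * c)%:E)%E.
Proof.
move=> mf mg fa gb fgc.
have sqr_int (h : X -> R) (r : R) : measurable_fun setT h ->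
    (\int[mu]_w (h w * h w)%:E = r%:E)%E ->
    mu.-integrable setT (fun w => (h w * h w)%:E).
  move=> mh hr; apply/integrableP; split.
    by apply/measurable_EFinP; exact: measurable_funM.
  under eq_integral => w _ do rewrite gee0_abs ?lee_fin -?expr2 ?sqr_ge0//.
  by move: hr; under eq_integral do rewrite -expr2; move=> ->; rewrite ltry.
have iff := sqr_int f a mf fa; have igg := sqr_int g b mg gb.
have isum : mu.-integrable setT (fun w => (f w * f w + g w * g w)%:E).
  by apply: eq_integrable (integrableD measurableT iff igg).
have ifg : mu.-integrable setT (fun w => (f w * g w)%:E).
  apply: le_integrable isum => //.
    by apply/measurable_EFinP; exact: measurable_funM.
  move=> w _ /=; rewrite lee_fin [leRHS]ger0_norm ?addr_ge0 -?expr2 ?sqr_ge0//.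
  rewrite ler_norml; have := sqr_ge0 (f w - g w); have := sqr_ge0 (f w + g w).
  by move=> ? ?; apply/andP; split; nra.
have ifg2 : mu.-integrable setT (fun w => (2 * (f w * g w))%:E).
  by apply: eq_integrable (integrableZl measurableT 2 ifg).
under eq_integral => w _.
  rewrite (_ : (f w - g w) ^+ 2 = f w * f w + g w * g w - 2 * (f w * g w)); last by ring.
  rewrite EFinB; over.
rewrite integralB//; under eq_integral do rewrite EFinD.
rewrite integralD//; under [X in (_ - X)%E]eq_integral do rewrite EFinM.
rewrite integralZl// fa gb fgc.
by rewrite -EFinM.
Qed.

(** The variance of a scalar increment when [sigma] is the identity. *)
Definition increment_kernel (R : realType) (k : nat) (beta t : R)
    (x : 'rV[R]_k) (s : R) (y : 'rV[R]_k) : R :=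
  complex.Re (wave_kernel beta t x t x) + complex.Re (wave_kernel beta s y s y)
  - 2 * complex.Re (wave_kernel beta t x s y).

Lemma enorm_sqr (R : realType) (n : nat) (x : 'rV[R]_n) :
  enorm x ^+ 2 = \sum_(i < n) x 0 i ^+ 2.
Proof.
rewrite sqr_sqrtr; first by apply: eq_bigr => i _; rewrite expr2.
by apply: sumr_ge0 => i _; rewrite -expr2 sqr_ge0.
Qed.

(** All components share the same kernel, so summing the variances of their
    increments yields the trace of [sigma sigma^T] as a factor. *)
Lemma expectation_increment (R : realType) (k d : nat) (sigma : 'M[R]_d)
    (beta T : R) (disp : measure_display) (Omega : measurableType disp)
    (P : probability Omega R) (u : R -> 'rV[R]_k -> Omega -> 'rV[R]_d) :
  stochastic_wave_solution P sigma beta T u ->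
  forall (t s : R) (x y : 'rV[R]_k), 0 <= t <= T -> 0 <= s <= T ->
  ('E_P[fun w => (enorm (u t x w - u s y w) ^+ 2)%R] =
   (\tr (sigma *m sigma^T) * increment_kernel beta t x s y)%:E)%E.
Proof.
move=> [[mu _] cov] t s x y tT sT.
rewrite unlock.
under eq_integral => w _.
  rewrite enorm_sqr -sumEFin; over.
rewrite ge0_integral_sum//; last 2 first.
- move=> i; apply/measurable_EFinP; apply: measurable_funX.
  apply: (eq_measurable_fun (fun w => u t x w 0 i - u s y w 0 i)).
    by move=> w _; rewrite !mxE.
  by apply: measurable_funB; exact: mu.
- by move=> i w _; rewrite lee_fin sqr_ge0.
rewrite /mxtrace mulr_suml -sumEFin; apply: eq_bigr => i _.
have covRe t' x' s' y' : 0 <= t' <= T -> 0 <= s' <= T ->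
    (\int[P]_w (u t' x' w 0 i * u s' y' w 0 i)%:E =
     ((sigma *m sigma^T) i i * complex.Re (wave_kernel beta t' x' s' y'))%:E)%E.
  move=> t'T s'T; have [c] := cov t' x' s' y' i i t'T s'T.
  rewrite unlock => -> /(congr1 (@complex.Re R)) /= ->.
  case: (wave_kernel beta t' x' s' y') => a b /=.
  by rewrite mul0r subr0.
under eq_integral => w _ do rewrite !mxE.
have -> := integral_sqrB (mu t x i tT) (mu s y i sT) (covRe t x t x tT tT)
  (covRe s y s y sT sT) (covRe t x s y tT sT).
have alg (e a b c : R) : e * a + e * b - 2 * (e * c) = e * (a + b - 2 * c) by ring.
by rewrite alg.
Qed.

(** The trace is the sum of the squared entries of [sigma]. *)
Lemma trace_mulmx_tr_gt0 (R : realType) (d : nat) (sigma : 'M[R]_d) :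
  (0 < d)%N -> sigma \in unitmx -> 0 < \tr (sigma *m sigma^T).
Proof.
case: d sigma => // d sigma _ su.
have trE : \tr (sigma *m sigma^T) = \sum_i \sum_j sigma i j ^+ 2.
  by apply: eq_bigr => i _; rewrite !mxE; apply: eq_bigr => j _; rewrite mxE expr2.
have ge0 : 0 <= \tr (sigma *m sigma^T).
  by rewrite trE; apply: sumr_ge0 => i _; apply: sumr_ge0 => j _; exact: sqr_ge0.
rewrite lt_neqAle ge0 andbT eq_sym; apply: contraTneq su => tr0.
have s0 : sigma = 0.
  have h i : true -> 0 <= \sum_j sigma i j ^+ 2.
    by move=> _; apply: sumr_ge0 => j _; exact: sqr_ge0.
  apply/matrixP => i j; rewrite mxE; apply/eqP; rewrite -sqrf_eq0; apply/eqP.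
  move: tr0; rewrite trE => /(psumr_eq0P (fun i _ => h i isT)) /(_ i isT).
  by move=> /(psumr_eq0P (fun j _ => sqr_ge0 (sigma i j))) /(_ j isT).
by rewrite s0 unitmxE det0 unitr0.
Qed.

(** * The increment of the kernel as an integral of a square *)

Definition spectral_kernel (R : realType) (k : nat) (beta t s : R)
    (z : 'rV[R]_k) (r : R) (p : k.-tuple (measurableTypeR R)) : R :=
  cos (dotp (row_of_tuple p) z) *
  (FG (t - r) (row_of_tuple p) * FG (s - r) (row_of_tuple p) *
   spectral_density beta (row_of_tuple p)).

Lemma Re_wave_kernel (R : realType) (k : nat) (beta t : R) (x : 'rV[R]_k)
    (s : R) (y : 'rV[R]_k) :
  complex.Re (wave_kernel beta t x s y) =
  \int[@lebesgue_measure R]_(r in `[0, Num.min t s])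
    \int[lebesgue_measure_tuple R k]_p spectral_kernel beta t s (x - y) r p.
Proof.
rewrite /wave_kernel /Cintegral /=; apply: eq_Rintegral => r _.
by apply: eq_Rintegral => p _ /=; rewrite mulr0 subr0.
Qed.

Lemma measurable_FG (R : realType) (k : nat) (d : measure_display)
    (X : measurableType d) (f : X -> R) (g : X -> k.-tuple (measurableTypeR R)) :
  measurable_fun setT f -> measurable_fun setT g ->
  measurable_fun setT (fun x => FG (f x) (row_of_tuple (g x))).
Proof.
move=> mf mg.
have ml : measurable_fun setT (fun x => enorm (row_of_tuple (g x))).
  exact: (measurableT_comp (@measurable_enorm_tuple R k) mg).
apply: measurable_funM.
  apply: (measurableT_comp (continuous_measurable_fun (@continuous_sin R))).
  exact: measurable_funM.
exact: (measurableT_comp (@measurable_invr R) ml).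
Qed.

Lemma measurable_spectral_kernel (R : realType) (k : nat) (beta t s : R)
    (z : 'rV[R]_k) :
  measurable_fun setT (fun q : measurableTypeR R * k.-tuple (measurableTypeR R) =>
    spectral_kernel beta t s z q.1 q.2).
Proof.
apply: measurable_funM.
  apply: (measurableT_comp (continuous_measurable_fun (@continuous_cos R))).
  exact: (measurableT_comp (@measurable_dotp_tuple R k z) measurable_snd).
apply: measurable_funM.
  apply: measurable_funM; apply: measurable_FG => //.
  - exact: measurable_funB.
  - exact: measurable_funB.
apply: (measurableT_comp (measurable_powR _)).
exact: (measurableT_comp (@measurable_enorm_tuple R k) measurable_snd).
Qed.

Definition profile_const (R : realType) (k : nat) (beta : R) : R :=
  (2 * (k%:R / beta + k%:R / (2 - beta))) ^+ k.

(** Integrability and size of any spectral integral come from domination by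
    [profile]. *)
Lemma Rintegral_profile_le (R : realType) (k : nat) (beta a c : R)
    (h : k.-tuple (measurableTypeR R) -> R) :
  (0 < k)%N -> 0 < beta -> beta < 2 -> beta < k%:R -> 0 < a -> 0 <= c ->
  measurable_fun setT h ->
  (forall p, `|h p| <= c * profile (beta - k%:R) a (enorm (row_of_tuple p))) ->
  (lebesgue_measure_tuple R k).-integrable setT (EFin \o h) /\
  `|\int[lebesgue_measure_tuple R k]_p h p| <=
    c * (profile_const k beta * a `^ (2 - beta)).
Proof.
move=> k0 b0 b2 bk a0 c0 mh hp.
have mprof : measurable_fun setT (fun p : k.-tuple (measurableTypeR R) =>
    profile (beta - k%:R) a (enorm (row_of_tuple p))).
  apply: (measurableT_comp (measurable_profile _ _)).
  exact: measurable_enorm_tuple.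
have le1 : (\int[lebesgue_measure_tuple R k]_p `|h p|%:E <=
    (c * (profile_const k beta * a `^ (2 - beta)))%:E)%E.
  apply: (@le_trans _ _ (\int[lebesgue_measure_tuple R k]_p
    (c%:E * (profile (beta - k%:R) a (enorm (row_of_tuple p)))%:E))%E).
    apply: ge0_le_integral => //.
    - by apply/measurable_EFinP; exact: measurableT_comp.
    - by apply: measurable_funeM; exact/measurable_EFinP.
    - by move=> p _; rewrite -EFinM lee_fin.
  rewrite ge0_integralZl_EFin//; last 2 first.
  - by move=> p _; rewrite lee_fin profile_ge0.
  - exact/measurable_EFinP.
  rewrite EFinM; apply: lee_wpmul2l; first by rewrite lee_fin.
  exact: integral_profile.
have ih : (lebesgue_measure_tuple R k).-integrable setT (EFin \o h).
  apply/integrableP; split; first exact/measurable_EFinP.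
  by apply: le_lt_trans le1 _; rewrite ltry.
split=> //; apply: (le_trans (le_normr_Rintegral _ ih)) => //.
by rewrite -lee_fin; apply: le_trans le1; rewrite /Rintegral fineK//;
  apply: integrable_fin_num => //; exact: integrable_norm.
Qed.

Lemma norm_spectral_kernel_le (R : realType) (k : nat) (beta t s a r : R)
    (z : 'rV[R]_k) (p : k.-tuple (measurableTypeR R)) :
  `|t - r| <= a -> `|s - r| <= a ->
  `|spectral_kernel beta t s z r p| <=
    1 * profile (beta - k%:R) a (enorm (row_of_tuple p)).
Proof.
move=> tr sr; rewrite mul1r /spectral_kernel normrM.
apply: (@le_trans _ _ (1 * (`|FG (t - r) (row_of_tuple p)| *
    `|FG (s - r) (row_of_tuple p)| * spectral_density beta (row_of_tuple p)))).
  rewrite ler_pM ?cos_max// !normrM [X in _ * X]ger0_norm//.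
  exact: powR_ge0.
rewrite mul1r mulrC ler_wpM2l ?powR_ge0// expr2.
have mono t' : `|t' - r| <= a -> `|FG (t' - r) (row_of_tuple p)| <=
    Num.min a (enorm (row_of_tuple p))^-1.
  move=> ta; apply: (le_trans (norm_FG_le _ _)).
  by rewrite le_min !ge_min ta lexx orbT.
by apply: ler_pM => //; exact: mono.
Qed.

(** Signed parametric integrals are handled through positive and negative
    parts, to which Tonelli applies. *)
Lemma measurable_fun_Rintegral (R : realType) (d1 d2 : measure_display)
    (T1 : measurableType d1) (T2 : measurableType d2)
    (m2 : {sigma_finite_measure set T2 -> \bar R}) (f : T1 * T2 -> R) :
  measurable_fun setT f ->
  measurable_fun setT (fun x => \int[m2]_y f (x, y)).
Proof.
move=> mf; apply: (@measurableT_comp _ _ _ _ _ _ (@fine R)) => //.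
have mF : measurable_fun setT (EFin \o f) by exact/measurable_EFinP.
under eq_fun do rewrite integralE.
apply: emeasurable_funB.
  have := @measurable_fun_fubini_tonelli_F _ _ _ _ _ m2 _
    (measurable_funepos mF) (funepos_ge0 _).
  apply: eq_measurable_fun => x _.
  by apply: eq_integral => y _; rewrite !funeposE.
have := @measurable_fun_fubini_tonelli_F _ _ _ _ _ m2 _
  (measurable_funeneg mF) (funeneg_ge0 _).
apply: eq_measurable_fun => x _.
by apply: eq_integral => y _; rewrite !funenegE.
Qed.

Definition time_kernel (R : realType) (k : nat) (beta t s : R) (z : 'rV[R]_k)
    (r : R) : R :=
  \int[lebesgue_measure_tuple R k]_p spectral_kernel beta t s z r p.

Lemma integrable_spectral_kernel (R : realType) (k : nat) (beta t s r : R)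
    (z : 'rV[R]_k) :
  (0 < k)%N -> 0 < beta -> beta < 2 -> beta < k%:R ->
  (lebesgue_measure_tuple R k).-integrable setT
    (EFin \o spectral_kernel beta t s z r).
Proof.
move=> k0 b0 b2 bk.
pose a := `|t - r| + `|s - r| + 1.
have a0 : 0 < a by rewrite ltr_wpDl// addr_ge0.
apply: (@Rintegral_profile_le R k beta a 1 (spectral_kernel beta t s z r) _ _ _ _ _ _ _ _).1 => //.
- exact: measurableT_comp (measurable_spectral_kernel _ _ _ _) (measurable_pair1 _).
- move=> p; apply: norm_spectral_kernel_le.
    by rewrite /a -addrA lerDl addr_ge0.
  by rewrite /a addrAC lerDr addr_ge0.
Qed.

Lemma integrable_time_kernel (R : realType) (k : nat) (beta t s a : R)
    (z : 'rV[R]_k) (i : interval R) :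
  (0 < k)%N -> 0 < beta -> beta < 2 -> beta < k%:R -> 0 < a ->
  (@lebesgue_measure R [set` i] < +oo)%E ->
  (forall r, r \in i -> `|t - r| <= a /\ `|s - r| <= a) ->
  (@lebesgue_measure R).-integrable [set` i] (EFin \o time_kernel beta t s z).
Proof.
move=> k0 b0 b2 bk a0 mi ia.
apply: measurable_bounded_integrable => //.
- apply: measurable_funTS.
  exact: (@measurable_fun_Rintegral _ _ _ _ _ (lebesgue_measure_tuple R k)
    (fun q => spectral_kernel beta t s z q.1 q.2)
    (@measurable_spectral_kernel R k beta t s z)).
- exists (1 * (profile_const k beta * a `^ (2 - beta))); split; first exact: num_real.
  move=> B ltB r /= ri; apply: le_trans (ltW ltB).
  have [tr sr] := ia r ri.
  apply: (@Rintegral_profile_le R k beta a 1 (spectral_kernel beta t s z r) _ _ _ _ _ _ _ _).2 => //.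
  + exact: measurableT_comp (measurable_spectral_kernel _ _ _ _) (measurable_pair1 _).
  + by move=> p; exact: norm_spectral_kernel_le.
Qed.

(** [|e^(i th) FG(t - r) - FG(s - r)|^2] against the spectral density, where
    [th = xi.z]. *)
Definition wave_quad (R : realType) (k : nat) (beta t s : R) (z : 'rV[R]_k)
    (r : R) (p : k.-tuple (measurableTypeR R)) : R :=
  (FG (t - r) (row_of_tuple p) ^+ 2 + FG (s - r) (row_of_tuple p) ^+ 2 -
   2 * cos (dotp (row_of_tuple p) z) *
     (FG (t - r) (row_of_tuple p) * FG (s - r) (row_of_tuple p))) *
  spectral_density beta (row_of_tuple p).

Lemma dotp0 (R : realType) (k : nat) (x : 'rV[R]_k) : dotp x 0 = 0.
Proof. by rewrite /dotp big1// => i _; rewrite mxE mulr0. Qed.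

Lemma spectral_kernel_diag (R : realType) (k : nat) (beta t r : R)
    (p : k.-tuple (measurableTypeR R)) :
  spectral_kernel beta t t 0 r p =
  FG (t - r) (row_of_tuple p) ^+ 2 * spectral_density beta (row_of_tuple p).
Proof. by rewrite /spectral_kernel dotp0 cos0 mul1r expr2. Qed.

Lemma wave_quadE (R : realType) (k : nat) (beta t s : R) (z : 'rV[R]_k)
    (r : R) (p : k.-tuple (measurableTypeR R)) :
  wave_quad beta t s z r p =
  spectral_kernel beta t t 0 r p + spectral_kernel beta s s 0 r p
  - 2 * spectral_kernel beta t s z r p.
Proof. by rewrite !spectral_kernel_diag /wave_quad /spectral_kernel; ring. Qed.

(** It is [(A - c B)^2 + (1 - c^2) B^2] times a nonnegative density. *)
Lemma wave_quad_ge0 (R : realType) (k : nat) (beta t s : R) (z : 'rV[R]_k)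
    (r : R) (p : k.-tuple (measurableTypeR R)) : 0 <= wave_quad beta t s z r p.
Proof.
rewrite mulr_ge0 ?powR_ge0//.
set A := FG (t - r) _; set B := FG (s - r) _; set c := cos _.
have c1 : c ^+ 2 <= 1.
  by have := cos_le1 (dotp (row_of_tuple p) z);
     have := cos_geN1 (dotp (row_of_tuple p) z); rewrite -/c; nra.
have := sqr_ge0 (A - c * B); have := sqr_ge0 B; nra.
Qed.

(** Stated with free right-hand sides, so that the covariance kernels stay
    folded when the three representations are substituted. *)
Lemma increment_kernel_eq (R : realType) (k : nat) (beta t : R)
    (x : 'rV[R]_k) (s : R) (y : 'rV[R]_k) (a b c : R) :
  complex.Re (wave_kernel beta t x t x) = a ->
  complex.Re (wave_kernel beta s y s y) = b ->
  complex.Re (wave_kernel beta t x s y) = c ->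
  increment_kernel beta t x s y = a + b - 2 * c.
Proof. by rewrite /increment_kernel; move=> <- <- <-. Qed.

(** The noise before time [s] acts on both solutions and contributes a square;
    the noise on [s, t] acts on the later one only. *)
Lemma increment_kernelE (R : realType) (k : nat) (beta t s : R) (x y : 'rV[R]_k) :
  (0 < k)%N -> 0 < beta -> beta < 2 -> beta < k%:R -> 0 < s -> s <= t ->
  increment_kernel beta t x s y =
  \int[@lebesgue_measure R]_(r in `[0, s])
    (\int[lebesgue_measure_tuple R k]_p wave_quad beta t s (x - y) r p) +
  \int[@lebesgue_measure R]_(r in `]s, t]) time_kernel beta t t (0 : 'rV[R]_k) r.
Proof.
move=> k0 b0 b2 bk s0 st; have t0 : 0 < t by exact: lt_le_trans st.
have ReE t' (x' : 'rV[R]_k) s' (y' : 'rV[R]_k) : complex.Re (wave_kernel beta t' x' s' y') =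
    \int[@lebesgue_measure R]_(r in `[0, Num.min t' s'])
      time_kernel beta t' s' (x' - y') r by exact: Re_wave_kernel.
have -> : increment_kernel beta t x s y =
    \int[@lebesgue_measure R]_(r in `[0, t]) time_kernel beta t t (0 : 'rV[R]_k) r +
    \int[@lebesgue_measure R]_(r in `[0, s]) time_kernel beta s s (0 : 'rV[R]_k) r -
    2 * \int[@lebesgue_measure R]_(r in `[0, s]) time_kernel beta t s (x - y) r.
  have e1 := ReE t x t x; have e2 := ReE s y s y; have e3 := ReE t x s y.
  rewrite subrr minxx in e1; rewrite subrr minxx in e2; rewrite (min_r st) in e3.
  exact: (@increment_kernel_eq R k beta t x s y _ _ _ e1 e2 e3).
have itv_fin (b1 be : bool) (u v : R) :
    (@lebesgue_measure R [set` Interval (BSide b1 u) (BSide be v)] < +oo)%E.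
  by rewrite lebesgue_measure_itv/=; case: ifP => // _; rewrite -EFinD ltry.
have itk (t' s' : R) (z : 'rV[R]_k) (b1 be : bool) (u v : R) :
    0 <= u -> v <= t -> 0 <= t' <= t -> 0 <= s' <= t ->
    (@lebesgue_measure R).-integrable [set` Interval (BSide b1 u) (BSide be v)]
      (EFin \o time_kernel beta t' s' z).
  move=> u0 vt /andP[t'0 t't] /andP[s'0 s't].
  apply: (@integrable_time_kernel _ _ _ _ _ t) => //.
  move=> r ri; have [ur rv] : u <= r /\ r <= v.
    by move: ri; case: b1; case: be => /=; rewrite in_itv/= => /andP[];
      [move=> + /ltW|split|move=> /ltW + /ltW|move=> /ltW].
  by rewrite !ler_norml; split; apply/andP; split; lra.
have Wk r : \int[lebesgue_measure_tuple R k]_p wave_quad beta t s (x - y) r p =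
    time_kernel beta t t (0 : 'rV[R]_k) r + time_kernel beta s s (0 : 'rV[R]_k) r
    - 2 * time_kernel beta t s (x - y) r.
  rewrite /time_kernel; under eq_Rintegral do rewrite wave_quadE.
  have isk t' s' z := @integrable_spectral_kernel R k beta t' s' r z k0 b0 b2 bk.
  rewrite RintegralB//; last 2 first.
  - exact: eq_integrable (integrableD measurableT (isk t t 0) (isk s s 0)).
  - exact: eq_integrable (integrableZl measurableT 2 (isk t s (x - y))).
  by rewrite RintegralD// RintegralZl.
under [X in _ = X + _]eq_Rintegral do rewrite Wk.
have s00 : 0 <= s by exact: ltW.
have t00 : 0 <= t by exact: ltW.
have tt : 0 <= t <= t by rewrite t00 lexx.
have ts : 0 <= s <= t by rewrite s00 st.
rewrite (_ : `[0, t]%classic = `[0, s] `|` `]s, t]); last first.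
  by rewrite -itv_bndbnd_setU ?bnd_simp.
rewrite Rintegral_setU//; last 2 first.
- by rewrite -itv_bndbnd_setU ?bnd_simp//; exact: itk.
- apply/disj_setPS => r [] /=; rewrite !in_itv/= => /andP[_ rs] /andP[sr _].
  by have := lt_le_trans sr rs; rewrite ltxx.
have i1 := itk t t (0 : 'rV[R]_k) true false 0 s (lexx 0) st tt tt.
have i2 := itk s s (0 : 'rV[R]_k) true false 0 s (lexx 0) st ts ts.
have i3 := itk t s (x - y) true false 0 s (lexx 0) st tt ts.
rewrite RintegralB//; last 2 first.
- exact: eq_integrable (integrableD _ i1 i2).
- exact: eq_integrable (integrableZl _ 2 i3).
rewrite RintegralD// RintegralZl//.
have alg (a1 a2 b c : R) : a1 + a2 + b - 2 * c = a1 + b - 2 * c + a2 by ring.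
exact: alg.
Qed.

(** * Upper bound *)

Lemma measurable_wave_quad (R : realType) (k : nat) (beta t s : R)
    (z : 'rV[R]_k) :
  measurable_fun setT (fun q : measurableTypeR R * k.-tuple (measurableTypeR R) =>
    wave_quad beta t s z q.1 q.2).
Proof.
under eq_fun do rewrite wave_quadE.
apply: measurable_funB.
  by apply: measurable_funD; exact: measurable_spectral_kernel.
by apply: measurable_funM => //; exact: measurable_spectral_kernel.
Qed.

Lemma measurable_wave_quad_r (R : realType) (k : nat) (beta t s r : R)
    (z : 'rV[R]_k) :
  measurable_fun setT (wave_quad beta t s z r).
Proof.
exact: measurableT_comp (measurable_wave_quad beta t s z) (measurable_pair1 _).
Qed.

Lemma integral_le_cst (R : realType) (f : R -> R) (i : interval R) (B l : R) :
  measurable_fun [set: measurableTypeR R] f -> @lebesgue_measure R [set` i] = l%:E ->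
  0 <= B -> (forall r, r \in i -> 0 <= f r <= B) ->
  (\int[@lebesgue_measure R]_(r in [set` i]) (f r)%:E <= (B * l)%:E)%E.
Proof.
move=> mf li B0 fB.
apply: (@le_trans _ _ (\int[@lebesgue_measure R]_(r in [set` i]) B%:E)%E).
  apply: ge0_le_integral => //.
  - by move=> r /= /fB /andP[? _]; rewrite lee_fin.
  - by apply/measurable_EFinP; exact: measurable_funTS.
  - by move=> r /= /fB /andP[_ ?]; rewrite lee_fin.
by rewrite integral_cst// EFinM -li.
Qed.

Lemma Rintegral_le_cst (R : realType) (f : R -> R) (i : interval R) (B l : R) :
  measurable_fun [set: measurableTypeR R] f -> @lebesgue_measure R [set` i] = l%:E ->
  0 <= B -> (forall r, r \in i -> 0 <= f r <= B) ->
  \int[@lebesgue_measure R]_(r in [set` i]) f r <= B * l.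
Proof.
move=> mf li B0 fB; have := integral_le_cst mf li B0 fB.
have : (0 <= \int[@lebesgue_measure R]_(r in [set` i]) (f r)%:E)%E.
  by apply: integral_ge0 => r /= /fB /andP[? _]; rewrite lee_fin.
by rewrite /Rintegral; case: (\int[_]_(r in _) _)%E => //= r _.
Qed.

Lemma wave_quad_le (R : realType) (k : nat) (beta t s a r : R)
    (z : 'rV[R]_k) (p : k.-tuple (measurableTypeR R)) :
  `|t - s| <= a -> enorm z <= a ->
  `|wave_quad beta t s z r p| <=
    (4 + k%:R ^+ 2) * profile (beta - k%:R) a (enorm (row_of_tuple p)).
Proof.
move=> tsa za; rewrite ger0_norm ?wave_quad_ge0// /wave_quad /profile.
rewrite [leRHS]mulrCA mulrC ler_wpM2l ?powR_ge0//.
apply: (@FG_quadratic_le _ _ _ _ _ _ (enorm z)) => //.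
- exact: sqrtr_ge0.
- by rewrite opprB addrA subrK.
- exact: norm_dotp_le.
Qed.

Lemma Rintegral_wave_quad_bounds (R : realType) (k : nat) (beta t s a r : R)
    (z : 'rV[R]_k) :
  (0 < k)%N -> 0 < beta -> beta < 2 -> beta < k%:R -> 0 < a ->
  `|t - s| <= a -> enorm z <= a ->
  (lebesgue_measure_tuple R k).-integrable setT (EFin \o wave_quad beta t s z r) /\
  0 <= \int[lebesgue_measure_tuple R k]_p wave_quad beta t s z r p <=
    (4 + k%:R ^+ 2) * (profile_const k beta * a `^ (2 - beta)).
Proof.
move=> k0 b0 b2 bk a0 tsa za.
have k4 : 0 <= 4 + k%:R ^+ 2 :> R by rewrite addr_ge0// sqr_ge0.
have [int le] := @Rintegral_profile_le R k beta a (4 + k%:R ^+ 2)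
  (wave_quad beta t s z r) k0 b0 b2 bk a0 k4 (measurable_wave_quad_r _ _ _ _ _)
  (fun p => wave_quad_le beta r p tsa za).
split=> //; rewrite Rintegral_ge0/=; last by move=> p _; exact: wave_quad_ge0.
exact: le_trans (ler_norm _) le.
Qed.

Lemma measurable_Rintegral_wave_quad (R : realType) (k : nat) (beta t s : R)
    (z : 'rV[R]_k) :
  measurable_fun [set: measurableTypeR R]
    (fun r => \int[lebesgue_measure_tuple R k]_p wave_quad beta t s z r p).
Proof.
exact: (@measurable_fun_Rintegral _ _ _ _ _ (lebesgue_measure_tuple R k)
  (fun q => wave_quad beta t s z q.1 q.2) (@measurable_wave_quad R k beta t s z)).
Qed.

(** Both contributions are time integrals, over at most [T], of spectral
    integrals dominated by [profile] at scale [a]. *)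
Lemma increment_kernel_le (R : realType) (k : nat) (beta t s T : R)
    (x y : 'rV[R]_k) :
  (0 < k)%N -> 0 < beta -> beta < 2 -> beta < k%:R -> 0 < s -> s <= t -> t <= T ->
  0 < `|t - s| + enorm (x - y) ->
  increment_kernel beta t x s y <=
  (5 + k%:R ^+ 2) * T * profile_const k beta *
    (`|t - s| + enorm (x - y)) `^ (2 - beta).
Proof.
move=> k0 b0 b2 bk s0 st tT; set a := _ + _ => a0.
have e0 : 0 <= enorm (x - y) by exact: sqrtr_ge0.
have T0 : 0 < T by apply: lt_le_trans tT; exact: lt_le_trans st.
have tsa : `|t - s| <= a by rewrite /a lerDl.
have za : enorm (x - y) <= a by rewrite /a lerDr.
have c0 : 0 <= profile_const k beta * a `^ (2 - beta).
  rewrite mulr_ge0 ?powR_ge0// exprn_ge0// mulr_ge0// addr_ge0// divr_ge0//.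
    exact: ltW.
  by rewrite subr_ge0 ltW.
have k4 : 0 <= 4 + k%:R ^+ 2 :> R by rewrite addr_ge0// sqr_ge0.
rewrite increment_kernelE//.
have I1 : \int[@lebesgue_measure R]_(r in `[0, s])
    (\int[lebesgue_measure_tuple R k]_p wave_quad beta t s (x - y) r p) <=
    (4 + k%:R ^+ 2) * (profile_const k beta * a `^ (2 - beta)) * s.
  apply: Rintegral_le_cst.
  - exact: measurable_Rintegral_wave_quad.
  - by rewrite lebesgue_measure_itv/= lte_fin s0 -EFinD subr0.
  - exact: mulr_ge0.
  - by move=> r _; exact: (Rintegral_wave_quad_bounds _ k0 b0 b2 bk a0 tsa za).2.
have I2 : \int[@lebesgue_measure R]_(r in `]s, t]) time_kernel beta t t (0 : 'rV[R]_k) r <=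
    (profile_const k beta * a `^ (2 - beta)) * (t - s).
  apply: Rintegral_le_cst.
  - exact: (@measurable_fun_Rintegral _ _ _ _ _ (lebesgue_measure_tuple R k)
      (fun q => spectral_kernel beta t t (0 : 'rV[R]_k) q.1 q.2)
      (@measurable_spectral_kernel R k beta t t (0 : 'rV[R]_k))).
  - rewrite lebesgue_measure_itv/= lte_fin -EFinD; move: st.
    by rewrite le_eqVlt => /orP[/eqP ->|->]//; rewrite ltxx subrr.
  - by [].
  - move=> r; rewrite in_itv/= => /andP[sr rt].
    rewrite Rintegral_ge0; last first.
      by move=> p _; rewrite spectral_kernel_diag mulr_ge0 ?sqr_ge0 ?powR_ge0.
    apply: le_trans (ler_norm _) _; rewrite -[leRHS]mul1r.
    apply: (@Rintegral_profile_le R k beta a 1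
      (spectral_kernel beta t t 0 r) _ _ _ _ _ _ _ _).2 => //.
    + exact: measurableT_comp (measurable_spectral_kernel _ _ _ _) (measurable_pair1 _).
    + have tr : `|t - r| <= a.
        apply: le_trans tsa; rewrite !ger0_norm ?subr_ge0// lerD2l lerN2; exact: ltW.
      by move=> p; exact: norm_spectral_kernel_le.
apply: (le_trans (lerD I1 I2)).
rewrite -[leRHS]mulrA (_ : 5 + _ = 1 + (4 + k%:R ^+ 2)); last by ring.
move: (profile_const _ _ * _ `^ _) c0 (4 + _) k4 => c c0 n n0.
have h1 : 0 <= c * n * (T - s) by rewrite !mulr_ge0// subr_ge0 (le_trans st).
have h2 : 0 <= c * (T - (t - s)) by rewrite mulr_ge0//; lra.
lra.
Qed.

(** * Lower bound *)

(** Exact primitive in time of the right-hand side of [sin_quadratic]. *)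
Lemma integral_wave_quad (R : realType) (k : nat) (beta t s : R)
    (z : 'rV[R]_k) (p : k.-tuple (measurableTypeR R)) :
  0 < s -> 0 < enorm (row_of_tuple p) ->
  let l := enorm (row_of_tuple p) in
  let c := cos (dotp (row_of_tuple p) z) in
  let q := cos ((t - s) * l) in
  (\int[@lebesgue_measure R]_(r in `[0%R, s]) (wave_quad beta t s z r p)%:E =
   (l ^- 2 * spectral_density beta (row_of_tuple p) *
    ((1 - c * q) * s +
     (c - q) * ((sin ((t + s) * l) - sin ((t - s) * l)) / (2 * l))))%:E)%E.
Proof.
move=> s0 l0 l c q.
pose v := l ^- 2 * spectral_density beta (row_of_tuple p).
pose F r := v * (1 - c * q) * r - v * (c - q) / (2 * l) * sin ((t + s - 2 * r) * l).
have lN : l != 0 by rewrite gt_eqF.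
have quadE r : wave_quad beta t s z r p =
    v * (1 - c * q) + v * (c - q) * cos ((t + s - 2 * r) * l).
  rewrite /wave_quad /FG -/l -/c.
  have := sin_quadratic ((t - r) * l) ((s - r) * l) c.
  rewrite -mulrBl -mulrDl opprB addrA subrK -/q.
  rewrite (_ : t - r + (s - r) = t + s - 2 * r); last by ring.
  set A := sin _; set B := sin _; set C := cos _ => h.
  rewrite (_ : v * _ + _ = v * (1 - c * q + (c - q) * C)); last by ring.
  by rewrite -h /v; field.
rewrite (_ : l ^- 2 * _ * _ = F s - F 0); last first.
  rewrite /F -/v !mulr0 !subr0 (_ : t + s - 2 * s = t - s); last by ring.
  by field.
apply: (@integral_FTC _ (fun r => wave_quad beta t s z r p) F) => //.
  move=> r _.
  have dlin : is_derive r (1:R) (cst ((t + s) * l) + (- (2 * l)) \*: id) (0 + - (2 * l) *: 1).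
    exact: is_deriveD.
  have dsin : is_derive r (1:R)
      (sin \o (cst ((t + s) * l) + (- (2 * l)) \*: id))
      (cos (((t + s) * l) + (- (2 * l)) *: r) * (0 + - (2 * l) *: 1)).
    exact: is_derive1_comp.
  have dF := is_deriveD (is_deriveZ (v * (1 - c * q)) (is_derive_id r (1:R)))
    (is_deriveZ (- (v * (c - q) / (2 * l))) dsin).
  have FE : F = (v * (1 - c * q)) \*: id +
      (- (v * (c - q) / (2 * l))) \*: (sin \o (cst ((t + s) * l) + (- (2 * l)) \*: id)).
    apply/funext => y; transitivity (v * (1 - c * q) * y +
        - (v * (c - q) / (2 * l)) * sin ((t + s) * l + - (2 * l) * y)) => //.
    rewrite (_ : (t + s) * l + - (2 * l) * y = (t + s - 2 * y) * l); last by ring.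
    by rewrite /F mulNr.
  rewrite FE; apply: (is_derive_eq dF); rewrite quadE /GRing.scale/=.
  rewrite (_ : (t + s) * l + - (2 * l) * r = (t + s - 2 * r) * l); last by ring.
  by field.
move=> r _.
rewrite (_ : (fun r => _) =
    (fun r => v * (1 - c * q) + v * (c - q) * cos ((t + s - 2 * r) * l))); last first.
  by apply/funext => y; exact: quadE.
apply: continuousD; first exact: cst_continuous.
apply: continuousM; first exact: cst_continuous.
apply: continuous_comp; last exact: continuous_cos.
apply: continuousM; last exact: cst_continuous.
apply: continuousB; first exact: cst_continuous.
by apply: continuousM; [exact: cst_continuous|].
Qed.

(** With [c] and [q] the two cosines, [|c - q| <= 1 - c q], so the oscillating
    term costs at most a fraction [1 / (s |xi|)] of the mean [s (1 - c q)]; and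
    [1 - c q] dominates both [(1 - c^2) / 2] and [(1 - q^2) / 2]. Space and time
    increments thus separate. *)
Lemma integral_wave_quad_ge (R : realType) (k : nat) (beta t s : R)
    (z : 'rV[R]_k) (p : k.-tuple (measurableTypeR R)) :
  0 < s -> 0 < enorm (row_of_tuple p) -> 1 <= s * enorm (row_of_tuple p) ->
  let v := enorm (row_of_tuple p) ^- 2 * spectral_density beta (row_of_tuple p) *
    (s - (enorm (row_of_tuple p))^-1) / 2 in
  ((v * sin (dotp (row_of_tuple p) z) ^+ 2)%:E <=
    \int[@lebesgue_measure R]_(r in `[0%R, s]) (wave_quad beta t s z r p)%:E)%E /\
  ((v * sin ((t - s) * enorm (row_of_tuple p)) ^+ 2)%:E <=
    \int[@lebesgue_measure R]_(r in `[0%R, s]) (wave_quad beta t s z r p)%:E)%E.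
Proof.
move=> s0 l0 sl v; rewrite integral_wave_quad// !lee_fin !sin2cos2 /v.
set l := enorm _ in l0 sl *; set c := cos _; set q := cos _.
set S := _ / (2 * l).
set w := _ * spectral_density _ _.
have w0 : 0 <= w by rewrite mulr_ge0 ?powR_ge0// invr_ge0 sqr_ge0.
have c1 : -1 <= c <= 1 by rewrite cos_le1 cos_geN1.
have q1 : -1 <= q <= 1 by rewrite cos_le1 cos_geN1.
have l1 : 0 < l^-1 by rewrite invr_gt0.
have sl1 : l^-1 <= s by rewrite -[l^-1]mul1r ler_pdivrMr.
have S1 : - l^-1 <= S <= l^-1.
  rewrite -ler_norml /S normrM normfV (@gtr0_norm _ (2 * l)) ?mulr_gt0//.
  rewrite ler_pdivrMr ?mulr_gt0// mulrCA mulVf ?gt_eqF// mulr1.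
  apply: le_trans (ler_normB _ _) _.
  by rewrite -[leRHS]/(1 + 1); apply: lerD; exact: sin_max.
have cq : `|c - q| <= 1 - c * q.
  by rewrite ler_norml; move: c1 q1 => /andP[? ?] /andP[? ?]; apply/andP; split; nra.
have main : (1 - c * q) * (s - l^-1) <= (1 - c * q) * s + (c - q) * S.
  have : `|(c - q) * S| <= (1 - c * q) * l^-1.
    by rewrite normrM ler_pM// ler_norml.
  by rewrite ler_norml => /andP[? _]; lra.
have half (x y : R) : -1 <= x <= 1 -> -1 <= y <= 1 -> (1 - x ^+ 2) / 2 <= 1 - x * y.
  by move=> /andP[? ?] /andP[? ?]; have := sqr_ge0 (x - y); nra.
have fin (x : R) : (1 - x ^+ 2) / 2 <= 1 - c * q ->
    w * (s - l^-1) / 2 * (1 - x ^+ 2) <= w * ((1 - c * q) * s + (c - q) * S).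
  move=> hx; have sl2 : 0 <= s - l^-1 by rewrite subr_ge0.
  have := ler_wpM2l w0 (le_trans (ler_wpM2r sl2 hx) main).
  by rewrite [leLHS](_ : _ = w * (s - l^-1) / 2 * (1 - x ^+ 2)); last by ring.
by split; apply: fin; [exact: half|rewrite [c * q]mulrC; exact: half].
Qed.

Lemma enorm_cube (R : realType) (k : nat) (L : R)
    (p : k.-tuple (measurableTypeR R)) :
  (0 < k)%N -> 0 < L -> cube L (2 * L) p ->
  L <= enorm (row_of_tuple p) <= 2 * k%:R * L.
Proof.
move=> k0 L0 pL; apply/andP; split.
  have := coord_le_enorm (row_of_tuple p) (Ordinal k0); rewrite mxE.
  by apply: le_trans; have /andP[h _] := pL (Ordinal k0); rewrite (le_trans h)// ler_norm.
have k1 : 1 <= k%:R :> R by rewrite ler1n.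
rewrite -(@ler_pXn2r _ 2) ?nnegrE ?sqrtr_ge0 ?mulr_ge0 ?(ltW L0)//.
rewrite enorm_sqr (@le_trans _ _ (\sum_(i < k) (2 * L) ^+ 2))//.
  apply: ler_sum => i _; rewrite mxE; have /andP[h1 h2] := pL i.
  by rewrite ler_sqr ?nnegrE ?mulr_ge0 ?(ltW L0)//; apply: le_trans h1; exact: ltW.
rewrite sumr_const card_ord -[leLHS]mulr_natl.
have := sqr_ge0 L; nra.
Qed.

Lemma dotp_tuple_set (R : realType) (k : nat) (i : 'I_k) (x : R)
    (z : 'rV[R]_k) (p : k.-tuple (measurableTypeR R)) :
  dotp (row_of_tuple (tuple_set i x p)) z =
  x * z 0 i + \sum_(j < k | j != i) (tnth p j : R) * z 0 j.
Proof.
rewrite /dotp (bigD1 i)//= !mxE tnth_mktuple eqxx; congr (_ + _).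
by apply: eq_bigr => j ji; rewrite mxE tnth_mktuple (negbTE ji).
Qed.

Lemma enorm_tuple_set (R : realType) (k : nat) (i : 'I_k) (x : R)
    (p : k.-tuple (measurableTypeR R)) :
  enorm (row_of_tuple (tuple_set i x p)) =
  Num.sqrt (x ^+ 2 + \sum_(j < k | j != i) (tnth p j : R) ^+ 2).
Proof.
rewrite /enorm /dotp (bigD1 i)//= !mxE tnth_mktuple eqxx -expr2.
congr (Num.sqrt (_ + _)).
by apply: eq_bigr => j ji; rewrite mxE tnth_mktuple (negbTE ji) expr2.
Qed.

(** On a slice along coordinate [i] the phase [xi.z] is affine with slope
    [z 0 i], so it suffices that it runs over at least two radians. *)
Lemma cube_sin2_linear (R : realType) (k : nat) (i : 'I_k) (L : R) (z : 'rV[R]_k) :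
  0 < L -> 2 <= `|z 0 i| * L ->
  ((L ^+ k / (8 * k%:R))%:E <=
    \int[lebesgue_measure_tuple R k]_(p in cube L (2 * L))
      (sin (dotp (row_of_tuple p) z) ^+ 2)%:E)%E.
Proof.
move=> L0 zL.
have k0 : (0 < k)%N by case: k i z zL => [[]|].
have k1 : 1 <= k%:R :> R by rewrite ler1n.
have L2 : L < 2 * L by rewrite mulr_natl mulr2n ltrDl.
have z0 : 0 < `|z 0 i|.
  by rewrite lt_neqAle normr_ge0 andbT eq_sym; apply: contraTneq zL => ->;
    rewrite mul0r -ltNge.
have -> : L ^+ k / (8 * k%:R) = (L / (8 * k%:R)) * (2 * L - L) ^+ k.-1.
  rewrite (_ : 2 * L - L = L); last by ring.
  by rewrite -{1}(prednK k0) exprS mulrAC.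
apply: (@slice_le_cube R k i L (2 * L) (L / (8 * k%:R))
  (fun p => (sin (dotp (row_of_tuple p) z) ^+ 2)%:E)).
- exact: ltW.
- by rewrite divr_ge0 ?ltW// mulr_gt0// (lt_le_trans ltr01).
- apply/measurable_EFinP; apply: measurable_funX.
  apply: (measurableT_comp (continuous_measurable_fun (@continuous_sin R))).
  exact: measurable_dotp_tuple.
- by move=> p; rewrite lee_fin sqr_ge0.
move=> p _.
(* the square makes the sign of the phase irrelevant, so the slope can be
   taken positive *)
pose e := Num.sg (z 0 i).
pose b := \sum_(j < k | j != i) (tnth p j : R) * z 0 j.
pose g (x : R) := `|z 0 i| * x + e * b.
have sg : forall x, (sin (dotp (row_of_tuple (tuple_set i x p)) z) ^+ 2)%:E = (sin (g x) ^+ 2)%:E.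
  move=> x; congr EFin; rewrite dotp_tuple_set -/b.
  have -> : g x = e * (x * z 0 i + b) by rewrite /g normrEsg -/e; ring.
  by rewrite sin_sg exprMn sqr_sg -normr_gt0 z0 mul1r.
under eq_integral do rewrite sg.
apply: le_trans (@integral_sin2_ge R g (fun=> `|z 0 i|) L (2 * L) `|z 0 i| L2 z0 _ _ _).
- rewrite lee_fin /g.
  rewrite (_ : _ - _ - 1 = `|z 0 i| * L - 1); last by ring.
  rewrite ler_pdivlMr ?mulr_gt0//.
  apply: (@le_trans _ _ (L / 8 * (2 * `|z 0 i|))); last by lra.
  rewrite ler_wpM2r ?mulr_ge0// ler_pM2l// lef_pV2 ?posrE//; last by lra.
  by rewrite ler_peMr.
- move=> x _.
  have := is_deriveD (is_deriveZ `|z 0 i| (is_derive_id x (1:R)))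
     (is_derive_cst (e * b) x (1:R)).
  move=> h; apply: (is_derive_eq h); rewrite addr0 /GRing.scale/= mulr1//.
- by move=> x _; exact: cst_continuous.
- by move=> x _; rewrite normr_ge0 lexx.
Qed.

(** On a slice along any axis the phase is [h sqrt (x^2 + b)], with speed at most
    [h]; over [L, 2 L] it increases by [3 h L^2] divided by a sum of two radii,
    each at most [2 k L]. *)
Lemma cube_sin2_radial (R : realType) (k : nat) (L h : R) :
  (0 < k)%N -> 0 < L -> 4 * k%:R <= h * L ->
  ((L ^+ k / (8 * k%:R))%:E <=
    \int[lebesgue_measure_tuple R k]_(p in cube L (2 * L))
      (sin (h * enorm (row_of_tuple p)) ^+ 2)%:E)%E.
Proof.
move=> k0 L0 hL.
have k1 : 1 <= k%:R :> R by rewrite ler1n.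
have L2 : L < 2 * L by rewrite mulr_natl mulr2n ltrDl.
have h0 : 0 < h by rewrite -(pmulr_lgt0 _ L0); nra.
have -> : L ^+ k / (8 * k%:R) = (L / (8 * k%:R)) * (2 * L - L) ^+ k.-1.
  rewrite (_ : 2 * L - L = L); last by ring.
  by rewrite -{1}(prednK k0) exprS mulrAC.
pose i := Ordinal k0.
apply: (@slice_le_cube R k i L (2 * L) (L / (8 * k%:R))
  (fun p => (sin (h * enorm (row_of_tuple p)) ^+ 2)%:E)).
- exact: ltW.
- by rewrite divr_ge0 ?ltW// mulr_gt0// (lt_le_trans ltr01).
- apply/measurable_EFinP; apply: measurable_funX.
  apply: (measurableT_comp (continuous_measurable_fun (@continuous_sin R))).
  by apply: measurable_funM => //; exact: measurable_enorm_tuple.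
- by move=> p; rewrite lee_fin sqr_ge0.
move=> p pL.
pose b := \sum_(j < k | j != i) (tnth p j : R) ^+ 2.
have b0 : 0 <= b by apply: sumr_ge0 => j _; exact: sqr_ge0.
pose rad (x : R) := Num.sqrt (x ^+ 2 + b).
have radL x : x \in `[L, 2 * L] -> L <= rad x <= 2 * k%:R * L.
  move=> xL; rewrite /rad -enorm_tuple_set; apply: enorm_cube => //.
  move: xL; rewrite in_itv/= => xLL j; rewrite tnth_mktuple.
  by case: eqP => _ //; exact: pL.
have rad0 x : x \in `[L, 2 * L] -> 0 < rad x.
  by move=> /radL /andP[h1 _]; exact: lt_le_trans h1.
have rad2 x : rad x ^+ 2 = x ^+ 2 + b by rewrite sqr_sqrtr// addr_ge0// sqr_ge0.
pose g (x : R) := h * rad x.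
pose dg (x : R) := h * (x / rad x).
under eq_integral do rewrite enorm_tuple_set.
apply: le_trans (@integral_sin2_ge R g dg L (2 * L) h L2 h0 _ _ _).
- rewrite lee_fin /g.
  have LL : L \in `[L, 2 * L] by rewrite in_itv/= lexx ltW.
  have LL2 : 2 * L \in `[L, 2 * L] by rewrite in_itv/= lexx ltW.
  have /andP[? u1] := radL _ LL; have /andP[? u2] := radL _ LL2.
  have r1 := rad2 L; have r2 := rad2 (2 * L).
  have : L / (2 * k%:R) <= rad (2 * L) - rad L.
    have k2 : 0 < 2 * k%:R :> R by lra.
    have u0 : 0 <= rad (2 * L) - rad L.
      by rewrite subr_ge0 ler_wsqrtr// lerD2r ler_sqr ?nnegrE ?(ltW L0) ?mulr_ge0 ?ltW.
    (* difference of the squared radii at both ends of the slice *)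
    have prod : 3 * L ^+ 2 = (rad (2 * L) - rad L) * (rad (2 * L) + rad L).
      by rewrite -subr_sqr r1 r2; ring.
    have sum : (rad (2 * L) - rad L) * (rad (2 * L) + rad L) <=
        (rad (2 * L) - rad L) * (4 * k%:R * L).
      by rewrite ler_wpM2l//; lra.
    rewrite ler_pdivrMr// -(ler_pM2l L0).
    have := sqr_ge0 L; lra.
  have hm : 1 / 2 <= h * (L / (8 * k%:R)).
    rewrite mulrA ler_pdivlMr ?mulr_gt0//; lra.
  rewrite ler_pdivlMr ?mulr_gt0// => del.
  have {}del : 4 * (L / (8 * k%:R)) <= rad (2 * L) - rad L.
    by apply: le_trans del; rewrite le_eqVlt; apply/orP; left; apply/eqP; field; lra.
  have := ler_wpM2l (ltW h0) del; lra.
- move=> x xL.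
  have x0 : 0 < x by move: xL; rewrite in_itv/= => /andP[/(lt_le_trans L0)].
  have q0 : 0 < x ^+ 2 + b by rewrite ltr_pwDl// exprn_gt0.
  have d2 : is_derive x (1:R) (fun y : R => y ^+ 2 + b) (2 * x).
    have := is_deriveD (is_deriveX 2 (is_derive_id x (1:R))) (is_derive_cst b x (1:R)).
    by move=> H; apply: (is_derive_eq H); rewrite /GRing.scale/=; ring.
  have dr := @is_derive1_comp R Num.sqrt (fun y => y ^+ 2 + b) x _ _ (is_derive1_sqrt q0) d2.
  have dh := is_deriveZ h dr.
  apply: (is_derive_eq dh); rewrite /dg /rad /GRing.scale/=.
  have : Num.sqrt (x ^+ 2 + b) != 0 by rewrite gt_eqF// sqrtr_gt0.
  by move=> ?; field.
- move=> x xL.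
  apply: continuousM; first exact: cst_continuous.
  apply: continuousM; first by [].
  apply: continuousV; first by rewrite gt_eqF// rad0.
  apply: continuous_comp; last exact: sqrt_continuous.
  apply: continuousD; last exact: cst_continuous.
  exact: exprn_continuous.
- move=> x xL; have rx := rad0 x xL.
  have x0 : 0 < x by move: xL; rewrite in_itv/= => /andP[/(lt_le_trans L0)].
  apply/andP; split; first by apply/ltW; rewrite mulr_gt0// divr_gt0.
  rewrite ger_pMr// ler_pdivrMr// mul1r.
  rewrite -(@ler_pXn2r _ 2) ?nnegrE; [by rewrite rad2 lerDl|by []| |]; exact: ltW.
Qed.

(** Either some coordinate of [z] is large compared with [1 / L], or [enorm z] is
    so small that [h] carries the whole increment. *)
Lemma cube_sin2 (R : realType) (k : nat) (L h : R) (z : 'rV[R]_k) :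
  (0 < k)%N -> 0 < L -> 8 * k%:R <= (h + enorm z) * L ->
  ((L ^+ k / (8 * k%:R))%:E <= \int[lebesgue_measure_tuple R k]_(p in cube L (2 * L))
     (sin (dotp (row_of_tuple p) z) ^+ 2)%:E)%E \/
  ((L ^+ k / (8 * k%:R))%:E <= \int[lebesgue_measure_tuple R k]_(p in cube L (2 * L))
     (sin (h * enorm (row_of_tuple p)) ^+ 2)%:E)%E.
Proof.
move=> k0 L0 hzL.
have k1 : 1 <= k%:R :> R by rewrite ler1n.
have [[i zi]|nz] := pselect (exists i, 2 <= `|z 0 i| * L).
  by left; exact: (cube_sin2_linear L0 zi).
right; apply: cube_sin2_radial => //.
(* the coordinates of [L z] are at most 2 in absolute value, so its norm is at
   most [2 sqrt k <= 2 k] *)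
have zL : enorm z * L <= 2 * k%:R.
  rewrite -(@ler_pXn2r _ 2) ?nnegrE ?mulr_ge0 ?sqrtr_ge0 ?(ltW L0)//.
  rewrite exprMn enorm_sqr mulr_suml.
  apply: (@le_trans _ _ (\sum_(i < k) 2 ^+ 2)).
    apply: ler_sum => i _; rewrite -exprMn -(real_normK (num_real (_ * _))).
    rewrite ler_sqr ?nnegrE// normrM (gtr0_norm L0) ltW// ltNge.
    by apply/negP => zi; apply: nz; exists i.
  rewrite sumr_const card_ord -[leLHS]mulr_natl; nra.
lra.
Qed.

(** The frequencies are restricted to a cube at scale [L = N / a]. There the
    spectral weight is of order [L ^ (beta - k - 2)] and the volume of order
    [L ^ k], which produces [L ^ (beta - 2)], i.e. [a ^ (2 - beta)]. The constant
    [N = 8 k + 2 A / t0] makes the phases run far enough ([N >= 8 k]) and forces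
    [|xi| >= 2 / t0], so that the time integral over [0, s] averages out its
    oscillation. *)
Lemma increment_kernel_ge (R : realType) (k : nat) (beta t s t0 A : R)
    (x y : 'rV[R]_k) :
  (0 < k)%N -> 0 < beta -> beta < 2 -> beta < k%:R -> 0 < t0 -> t0 <= s -> s <= t ->
  let a := `|t - s| + enorm (x - y) in 0 < a -> a <= A ->
  (2 * k%:R) `^ (beta - k%:R - 2) * (t0 / 4) / (8 * k%:R) *
    (8 * k%:R + 2 * A / t0) `^ (beta - 2) * a `^ (2 - beta) <=
  increment_kernel beta t x s y.
Proof.
move=> k0 b0 b2 bk t00 ts st a a0 aA.
have k1 : 1 <= k%:R :> R by rewrite ler1n.
have kR : 0 < k%:R :> R by rewrite ltr0n.
have s0 : 0 < s by exact: lt_le_trans ts.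
have A0 : 0 < A by exact: lt_le_trans aA.
set N := 8 * k%:R + 2 * A / t0.
have At : 0 < A / t0 by exact: divr_gt0.
have N0 : 0 < N by rewrite /N -mulrA; lra.
pose L := N / a.
have L0 : 0 < L by exact: divr_gt0.
have La : a * L = N by rewrite /L mulrC divfK// gt_eqF.
have Lt : 2 / t0 <= L.
  rewrite /L ler_pdivlMr// (@le_trans _ _ (2 / t0 * A))//.
    by rewrite ler_pM2l// divr_gt0.
  by rewrite /N mulrAC lerDr mulr_ge0// ltW.
have h_abs : `|t - s| = t - s by rewrite ger0_norm// subr_ge0.
pose e := beta - k%:R - 2.
pose v0 := (2 * k%:R * L) `^ e * (t0 / 4).
have v00 : 0 <= v0 by rewrite mulr_ge0 ?powR_ge0// divr_ge0// ltW.
have e0 : e <= 0 by rewrite /e; lra.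
pose z := x - y.
pose W r := \int[lebesgue_measure_tuple R k]_p wave_quad beta t s z r p.
(* [true] selects the phase of the space increment, [false] that of the time
   increment *)
pose phase (p : k.-tuple (measurableTypeR R)) (b : bool) :=
  if b then dotp (row_of_tuple p) z else (t - s) * enorm (row_of_tuple p).
have pointwise p b : cube L (2 * L) p ->
   ((v0 * sin (phase p b) ^+ 2)%:E <=
    \int[@lebesgue_measure R]_(r in `[0%R, s]) (wave_quad beta t s z r p)%:E)%E.
  move=> pL; have /andP[lL lkL] := enorm_cube k0 L0 pL.
  have l0 : 0 < enorm (row_of_tuple p) by exact: lt_le_trans lL.
  have tl : 2 <= t0 * enorm (row_of_tuple p).
    by rewrite mulrC -ler_pdivrMr// (le_trans Lt).
  have sl : 2 <= s * enorm (row_of_tuple p).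
    by apply: (le_trans tl); rewrite ler_wpM2r// ltW.
  have [lin rad] := @integral_wave_quad_ge R k beta t s z p s0 l0 (le_trans (ler1n _ 2) sl).
  set v := _ / 2 in lin rad.
  have v0v : v0 <= v.
    rewrite /v0 /v -[leRHS]mulrA; apply: ler_pM; first exact: powR_ge0.
    - by rewrite divr_ge0// ltW.
    - rewrite (@le_trans _ _ (enorm (row_of_tuple p) `^ e))//.
        exact: powR_nonincreasing.
      rewrite /spectral_density -powR_invn ?(ltW l0)// -powRD; last by rewrite (gt_eqF l0) implybT.
      by rewrite le_eqVlt; apply/orP; left; apply/eqP; congr (_ `^ _); rewrite /e; ring.
    - have : (enorm (row_of_tuple p))^-1 <= t0 / 2.
        by rewrite -[leLHS]mul1r ler_pdivrMr//; lra.
      lra.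
  case: b; rewrite /phase; [apply: le_trans lin|apply: le_trans rad];
    by rewrite lee_fin ler_wpM2r// sqr_ge0.
have [b sinb] : exists b, ((L ^+ k / (8 * k%:R))%:E <=
    \int[lebesgue_measure_tuple R k]_(p in cube L (2 * L))
      (sin (phase p b) ^+ 2)%:E)%E.
  have : 8 * k%:R <= (t - s + enorm z) * L.
    rewrite -h_abs -/a La /N lerDl; rewrite -mulrA mulr_ge0// ltW//.
  by move=> /(cube_sin2 k0 L0) [h|h]; [exists true|exists false].
have mq := @measurable_wave_quad R k beta t s z.
have tsa : `|t - s| <= a by rewrite /a lerDl sqrtr_ge0.
have za : enorm z <= a by rewrite /a lerDr.
have Wb r := @Rintegral_wave_quad_bounds R k beta t s a r z k0 b0 b2 bk a0 tsa za.
have WE : ((\int[@lebesgue_measure R]_(r in `[0, s]) W r)%:E =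
  \int[lebesgue_measure_tuple R k]_p \int[@lebesgue_measure R]_(r in `[0%R, s])
    (wave_quad beta t s z r p)%:E)%E.
  have /= <- := @tonelli_in _ _ _ _ _ (@lebesgue_measure R) (lebesgue_measure_tuple R k)
    `[0, s]%classic setT (fun q => (wave_quad beta t s z q.1 q.2)%:E)
    (measurable_itv _) measurableT ((measurable_EFinP _ _).2 mq)
    (fun q => wave_quad_ge0 _ _ _ _ _ _).
  have WrE r : (\int[lebesgue_measure_tuple R k]_p (wave_quad beta t s z r p)%:E =
      (W r)%:E)%E.
    by rewrite /W /Rintegral fineK//; exact: integrable_fin_num (Wb r).1.
  under [RHS]eq_integral do rewrite WrE.
  rewrite /Rintegral fineK// ge0_fin_numE; last first.
    by apply: integral_ge0 => r _; rewrite lee_fin; have /andP[] := (Wb r).2.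
  apply: le_lt_trans (integral_le_cst (measurable_Rintegral_wave_quad _ _ _ _) _ _ _) (ltry _).
  - by rewrite lebesgue_measure_itv/= lte_fin s0 -EFinD subr0.
  - have /andP[h1 h2] := (Wb 0).2; exact: le_trans h2.
  - by move=> r _; exact: (Wb r).2.
rewrite increment_kernelE//.
rewrite -[leLHS]addr0 lerD//; last first.
  apply: Rintegral_ge0 => r _; apply: Rintegral_ge0 => p _.
  by rewrite spectral_kernel_diag mulr_ge0 ?sqr_ge0 ?powR_ge0.
rewrite -lee_fin WE.
have mphase : measurable_fun setT (fun p => sin (phase p b) ^+ 2).
  apply: measurable_funX.
  apply: (measurableT_comp (continuous_measurable_fun (@continuous_sin R))).
  rewrite /phase; case: (b); first exact: measurable_dotp_tuple.
  by apply: measurable_funM => //; exact: measurable_enorm_tuple.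
have mtime : measurable_fun setT (fun p : k.-tuple (measurableTypeR R) =>
    \int[@lebesgue_measure R]_(r in `[0%R, s]) (wave_quad beta t s z r p)%:E)%E.
  exact: (@measurable_integral_in1 _ _ _ _ _ (@lebesgue_measure R)
    `[0, s]%classic (fun q => (wave_quad beta t s z q.1 q.2)%:E)
    (measurable_itv _) ((measurable_EFinP _ _).2 mq)
    (fun q => wave_quad_ge0 _ _ _ _ _ _)).
have time0 p : (0 <= \int[@lebesgue_measure R]_(r in `[0%R, s])
    (wave_quad beta t s z r p)%:E)%E.
  by apply: integral_ge0 => r _; rewrite lee_fin wave_quad_ge0.
apply: (@le_trans _ _ (\int[lebesgue_measure_tuple R k]_(p in cube L (2 * L))
   (v0%:E * (sin (phase p b) ^+ 2)%:E))%E).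
  rewrite ge0_integralZl_EFin//; last 3 first.
  - exact: measurable_cube.
  - by move=> p _; rewrite lee_fin sqr_ge0.
  - by apply/measurable_EFinP; exact: measurable_funTS.
  apply: le_trans (lee_wpmul2l _ sinb); last by rewrite lee_fin.
  rewrite -EFinM lee_fin /v0 (@powRM _ (2 * k%:R) L) ?(ltW L0) ?mulr_ge0//.
  have -> : N `^ (beta - 2) = L `^ e * L ^+ k * a `^ (beta - 2).
    rewrite -La powRM ?(ltW a0) ?(ltW L0)// mulrC; congr (_ * _).
    rewrite -powR_mulrn ?(ltW L0)// -powRD; last by rewrite (gt_eqF L0) implybT.
    by congr (_ `^ _); rewrite /e; ring.
  have aa : a `^ (beta - 2) * a `^ (2 - beta) = 1.
    rewrite -powRD; last by rewrite (gt_eqF a0) implybT.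
    by rewrite -(powRr0 a); congr (_ `^ _); ring.
  rewrite -[leLHS]mulrA -[X in _ * X <= _]mulrA aa mulr1 -/e.
  by rewrite le_eqVlt; apply/orP; left; apply/eqP; ring.
apply: (@le_trans _ _ (\int[lebesgue_measure_tuple R k]_(p in cube L (2 * L))
   \int[@lebesgue_measure R]_(r in `[0%R, s])
    (wave_quad beta t s z r p)%:E)%E).
  apply: ge0_le_integral => //.
  - exact: measurable_cube.
  - by move=> p _; rewrite mule_ge0// lee_fin// sqr_ge0.
  - by apply: measurable_funeM; apply/measurable_EFinP; exact: measurable_funTS.
  - exact: measurable_funTS.
  - by move=> p pL; rewrite -EFinM; exact: pointwise.
by apply: ge0_subset_integral => //; exact: measurable_cube.
Qed.

(** * The two-sided estimate *)

Lemma enorm_eq0 (R : realType) (k : nat) (z : 'rV[R]_k) : enorm z = 0 -> z = 0.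
Proof.
move=> z0; apply/rowP => i; rewrite mxE; apply/eqP; rewrite -normr_le0 -z0.
exact: coord_le_enorm.
Qed.

Lemma increment_kernelxx (R : realType) (k : nat) (beta t : R) (x : 'rV[R]_k) :
  increment_kernel beta t x t x = 0.
Proof.
rewrite (increment_kernel_eq erefl erefl erefl).
have alg (a : R) : a + a - 2 * a = 0 by ring.
exact: alg.
Qed.

Lemma enormB_le (R : realType) (k : nat) (M : R) (x y : 'rV[R]_k) : 0 <= M ->
  (forall i, - M <= x 0 i <= M) -> (forall i, - M <= y 0 i <= M) ->
  enorm (x - y) <= 2 * M * k%:R.
Proof.
move=> M0 xM yM.
have k1 : (0 < k)%N -> 1 <= k%:R :> R by rewrite ler1n.
rewrite -(@ler_pXn2r _ 2) ?nnegrE ?sqrtr_ge0 ?mulr_ge0//.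
rewrite enorm_sqr (@le_trans _ _ (\sum_(i < k) (2 * M) ^+ 2))//.
  apply: ler_sum => i _; rewrite !mxE -(real_normK (num_real (_ - _))).
  rewrite ler_sqr ?nnegrE ?mulr_ge0// ler_norml.
  by have /andP[? ?] := xM i; have /andP[? ?] := yM i; apply/andP; split; lra.
rewrite sumr_const card_ord -[leLHS]mulr_natr [leRHS]exprMn ler_wpM2l ?sqr_ge0//.
by rewrite -natrX ler_nat; case: k {x y xM yM k1} => // n; rewrite leq_pmulr.
Qed.

Lemma profile_const_gt0 (R : realType) (k : nat) (beta : R) :
  (0 < k)%N -> 0 < beta -> beta < 2 -> 0 < profile_const k beta.
Proof.
move=> k0 b0 b2; rewrite exprn_gt0// mulr_gt0// addr_gt0// divr_gt0 ?ltr0n//.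
by rewrite subr_gt0.
Qed.

(** The points stay in a bounded set, hence so does the size of the increments;
    this is what allows the scale [L] of the lower bound to be chosen above
    [2 / t0] uniformly. For equal points both sides vanish. *)
Lemma wave_increment_bounds (R : realType) (k : nat) (beta t0 T M : R) :
  (0 < k)%N -> 0 < beta -> beta < 2 -> beta < k%:R -> 0 < t0 -> t0 < T -> 0 < M ->
  exists C1 C2 : R, [/\ 0 < C1, 0 < C2 &
    forall (t s : R) (x y : 'rV[R]_k), t0 <= s -> s <= t -> t <= T ->
      (forall i, - M <= x 0 i <= M) -> (forall i, - M <= y 0 i <= M) ->
      C1 * (`|t - s| + enorm (x - y)) `^ (2 - beta) <= increment_kernel beta t x s y
        <= C2 * (`|t - s| + enorm (x - y)) `^ (2 - beta)].
Proof.
move=> k0 b0 b2 bk t00 tT M0.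
have T0 : 0 < T by exact: lt_trans tT.
have kR : 0 < k%:R :> R by rewrite ltr0n.
pose A := T + 2 * M * k%:R.
have A0 : 0 < A by rewrite addr_gt0// !mulr_gt0.
exists ((2 * k%:R) `^ (beta - k%:R - 2) * (t0 / 4) / (8 * k%:R) *
    (8 * k%:R + 2 * A / t0) `^ (beta - 2)).
exists ((5 + k%:R ^+ 2) * T * profile_const k beta); split.
- have k2 (c : R) : 0 < c -> 0 < c * k%:R by move=> c0; exact: mulr_gt0.
  apply: mulr_gt0; last by rewrite powR_gt0// addr_gt0 ?k2// divr_gt0// mulr_gt0.
  by rewrite divr_gt0 ?k2// mulr_gt0 ?powR_gt0 ?k2// divr_gt0.
- by rewrite !mulr_gt0 ?profile_const_gt0// ltr_wpDr// sqr_ge0.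
move=> t s x y ts st tT' xM yM.
have e0 : 0 <= enorm (x - y) by exact: sqrtr_ge0.
have [a0|a0] := eqVneq (`|t - s| + enorm (x - y)) 0.
  have ts0 : t = s.
    apply/eqP; rewrite -subr_eq0 -normr_le0 -a0 lerDl//.
  have xy : x = y.
    apply/eqP; rewrite -subr_eq0; apply/eqP/enorm_eq0/eqP; rewrite eq_le e0 andbT.
    by rewrite -a0 lerDr.
  rewrite a0 ts0 xy increment_kernelxx powR0 ?mulr0 ?lexx// subr_eq0 gt_eqF//.
have {}a0 : 0 < `|t - s| + enorm (x - y) by rewrite lt_neqAle eq_sym a0 addr_ge0.
apply/andP; split.
  apply: increment_kernel_ge => //; apply: lerD; last by apply: enormB_le => //; exact: ltW.
  by rewrite ger0_norm ?subr_ge0//; lra.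
by apply: increment_kernel_le => //; exact: lt_le_trans ts.
Qed.

Theorem proposition4p1 (R : realType) (k d : nat) (hk : (1 <= k)%N)
    (hd : (1 <= d)%N) (sigma : 'M[R]_d) (hsigma : sigma \in unitmx)
    (t0 T : R) (ht0 : 0 < t0) (htT : t0 < T)
    (beta : R) (hbeta0 : 0 < beta) (hbeta : beta < Num.min 2 k%:R)
    (disp : measure_display) (Omega : measurableType disp)
    (P : probability Omega R)
    (u : R -> 'rV[R]_k -> Omega -> 'rV[R]_d)
    (hu : stochastic_wave_solution P sigma beta T u)
    (M : R) (hM : 0 < M) :
  exists C1 C2 : R, [/\ 0 < C1, 0 < C2 &
    forall (t s : R) (x y : 'rV[R]_k),
      t0 <= t <= T -> t0 <= s <= T ->
      (forall i, - M <= x 0 i <= M) -> (forall i, - M <= y 0 i <= M) ->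
      ((C1 * (`|t - s| + enorm (x - y)) `^ (2 - beta))%R%:E
        <= 'E_P[fun w => (enorm (u t x w - u s y w) ^+ 2)%R])%E /\
      ('E_P[fun w => (enorm (u t x w - u s y w) ^+ 2)%R]
        <= (C2 * (`|t - s| + enorm (x - y)) `^ (2 - beta))%R%:E)%E].
Proof.
have [b2 bk] : beta < 2 /\ beta < k%:R by apply/andP; rewrite -lt_min.
have [C1 [C2 [C10 C20 bounds]]] := wave_increment_bounds hk hbeta0 b2 bk ht0 htT hM.
have tr0 := trace_mulmx_tr_gt0 hd hsigma.
pose c := \tr (sigma *m sigma^T).
exists (c * C1), (c * C2); split; [exact: mulr_gt0|exact: mulr_gt0|].
have enormBC n (v w : 'rV[R]_n) : enorm (v - w) = enorm (w - v).
  by rewrite /enorm /dotp; congr Num.sqrt; apply: eq_bigr => i _; rewrite !mxE; ring.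
suff ordered t s (x y : 'rV[R]_k) : t0 <= t <= T -> t0 <= s <= T -> s <= t ->
      (forall i, - M <= x 0 i <= M) -> (forall i, - M <= y 0 i <= M) ->
      ((c * C1 * (`|t - s| + enorm (x - y)) `^ (2 - beta))%R%:E
        <= 'E_P[fun w => (enorm (u t x w - u s y w) ^+ 2)%R])%E /\
      ('E_P[fun w => (enorm (u t x w - u s y w) ^+ 2)%R]
        <= (c * C2 * (`|t - s| + enorm (x - y)) `^ (2 - beta))%R%:E)%E.
  move=> t s x y tT sT xM yM; have [st|/ltW ts] := leP s t; first exact: ordered.
  rewrite distrC enormBC.
  rewrite (_ : (fun w => _) = (fun w => enorm (u s y w - u t x w) ^+ 2)); last first.
    by apply/funext => w; rewrite enormBC.
  exact: ordered.
move=> /andP[t0t tT] /andP[t0s sT] st xM yM.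
rewrite (expectation_increment hu).
- rewrite !lee_fin -!mulrA !ler_pM2l//.
  by apply/andP; exact: bounds.
- by rewrite tT (le_trans (ltW ht0)).
- by rewrite sT (le_trans (ltW ht0)).
Qed.
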